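(* Let $n\geq 4$ be an integer and let $K$ be a convex body in $\mathbb{R}^n$ that is symmetric with respect to the origin. Then $$\mathrm{vol}_n(K)\,\mathrm{vol}_n(K^{\circ})\;\geq\;\alpha(n-1)\,\mathrm{vol}_{n-1}(\mathbb{S}^{n-1})^2\;=\;\frac{4\,\alpha(n-1)\,\pi^n}{\Gamma\left(\frac{n}{2}\right)^2},$$ where $\alpha(n-1)$ is the constant $\alpha(m)$ defined in the context, taken at $m=n-1$.
   Context: Polar body: for a convex body $K\subset\mathbb{R}^d$ symmetric about the origin, $K^{\circ}=\{x\in\mathbb{R}^d : |x\cdot y|\leq 1 \text{ for all } y\in K\}$, with $x\cdot y$ the Euclidean inner product. $\mathrm{vol}_n$ is Lebesgue measure on $\mathbb{R}^n$, $\mathrm{vol}_{n-1}(\mathbb{S}^{n-1})$ is the surface measure of the Euclidean unit sphere of $\mathbb{R}^n$, and $\Gamma$ is the Gamma function. Definition of $\alpha(m)$ for an integer $m\geq 3$. Let $B_2(0,r)\subset\mathbb{R}^2$ be the Euclidean disc of radius $r$ centred at the origin. Let $\mathcal{S}(1,\sqrt{m+1})$ be the class of convex bodies $S\subset\mathbb{R}^2$, symmetric about the origin, with $B_2(0,1)\subseteq S\subseteq B_2(0,\sqrt{m+1})$. Use polar coordinates $(r,t)$ on $\mathbb{R}^2$ with the angle $t$ measured from the positive $y$-axis, so $(x,y)=(r\sin t, r\cos t)$. For $\theta\in[0,\pi]$ put $g(\theta,t)=|\cos(t+\theta)|^{m-1}$ and let $\mu_{2,\theta}$ be the measure on $\mathbb{R}^2$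 given in polar coordinates by $r^m g(\theta,t)\,dr\,dt$ (for $\theta=0$ this is $|y|^{m-1}dx\,dy$). Let $\mathcal{A}$ be the class of geodesic segments (closed connected arcs, of length at most $\pi$) of the unit circle of $\mathbb{R}^2$; for $I\in\mathcal{A}$ let $C(I)=\{su : s\geq 0,\ u\in I\}$ be the convex cone generated by $I$. For $S\in\mathcal{S}(1,\sqrt{m+1})$, $\theta\in[0,\pi]$, $I\in\mathcal{A}$, set $$\alpha(m,\theta,I,S)=\frac{\mu_{2,\theta}(C(I)\cap S)\;\mu_{2,\theta}(C(I)\cap S^{\circ})}{\left(\int_I g(\theta,t)\,dt\right)^2},$$ where $S^\circ$ is the polar of $S$ in $\mathbb{R}^2$, $\int_I\cdot\,dt$ is integration over the angles of the points of $I$, and the quotient is set equal to $1$ when $I$ is a single point. Then define $$\alpha(m,S)=\max_{\theta\in[0,\pi]}\Big(\min_{I\in\mathcal{A}}\alpha(m,\theta,I,S)\Big),\qquad \alpha(m)=\min_{S\in\mathcal{S}(1,\sqrt{m+1})}\alpha(m,S),$$ where max and min are understood as supremum and infimum. *)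

(* Defs.v *)
From HB Require Import structures.
From mathcomp Require Import all_boot all_order all_algebra.
From mathcomp Require Import all_classical all_reals all_analysis.
Set Implicit Arguments.
Unset Strict Implicit.
Unset Printing Implicit Defensive.
Import Order.TTheory GRing.Theory Num.Theory.
Import numFieldNormedType.Exports.
Local Open Scope classical_set_scope.
Local Open Scope ring_scope.

(* The library has no Lebesgue measure on R^n: it is built here as the n-fold
   iterated product of the library's one-dimensional Lebesgue measure, on
   n.-tuple R with the product (= Borel) sigma-algebra. *)
Section lebesgue_tuple.
Context {R : realType}.
Local Notation T := (measurableTypeR R).

Section step.
Variables (n : nat) (mu : {sigma_finite_measure set (n.-tuple T) -> \bar R}).

Definition tuple_of_pair (p : T * n.-tuple T) : n.+1.-tuple T :=
  [the n.+1.-tuple T of p.1 :: p.2].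

Definition lebesgue_cons : set (n.+1.-tuple T) -> \bar R :=
  pushforward (@lebesgue_measure R \x mu)%E tuple_of_pair.

Let measurable_tuple_of_pair : measurable_fun setT tuple_of_pair.
Proof. exact: measurable_cons measurable_fst measurable_snd. Qed.

Let lebesgue_cons0 : lebesgue_cons set0 = 0%E.
Proof. by rewrite /lebesgue_cons /pushforward preimage_set0 measure0. Qed.

Let lebesgue_cons_ge0 A : (0 <= lebesgue_cons A)%E.
Proof.
by apply: integral_ge0 => x _; apply: measure_ge0.
Qed.

Let lebesgue_cons_sigma_additive : semi_sigma_additive lebesgue_cons.
Proof.
move=> F mF tF mUF; rewrite /lebesgue_cons /pushforward preimage_bigcup.
apply: measure_semi_sigma_additive.
- by move=> k; rewrite -[X in measurable X]setTI; exact: measurable_tuple_of_pair.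
- apply/trivIsetP => /= i j _ _ ij; rewrite -preimage_setI.
  by move/trivIsetP : tF => /(_ _ _ _ _ ij) ->//; rewrite preimage_set0.
- by rewrite -preimage_bigcup -[X in measurable X]setTI;
    exact: measurable_tuple_of_pair.
Qed.

HB.instance Definition _ := isMeasure.Build _ _ _ lebesgue_cons
  lebesgue_cons0 lebesgue_cons_ge0 lebesgue_cons_sigma_additive.

Let lebesgue_cons_sigma_finite : sigma_finite setT lebesgue_cons.
Proof.
pose split (t : n.+1.-tuple T) : T * n.-tuple T :=
  (tnth t ord0, [tuple of behead t]).
have msplit : measurable_fun setT split.
  apply/measurable_fun_pairP; split; first exact: measurable_tnth.
  exact: measurable_behead.
have /sigma_finiteP[F [TF ndF Foo]] := sigma_finiteT (@lebesgue_measure R).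
have /sigma_finiteP[G [TG ndG Goo]] := sigma_finiteT mu.
exists (fun k => split @^-1` (F k `*` G k)).
  rewrite -preimage_bigcup [X in split @^-1` X](_ : _ = setT) ?preimage_setT//.
  apply/seteqP; split => // -[x y] _.
  have [i _ Fix] : (\bigcup_k F k) x by rewrite -TF.
  have [j _ Gjy] : (\bigcup_k G k) y by rewrite -TG.
  exists (maxn i j) => //; split => /=.
    by move: x Fix; exact/subsetPset/ndF/leq_maxl.
  by move: y Gjy; exact/subsetPset/ndG/leq_maxr.
move=> k; have [mFk Fk] := Foo k; have [mGk Gk] := Goo k; split.
  by rewrite -[X in measurable X]setTI; apply: msplit => //; exact: measurableX.
rewrite /lebesgue_cons /pushforward -comp_preimage.
rewrite (_ : split \o tuple_of_pair = id) ?preimage_id.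
  by rewrite product_measure1E// lte_mul_pinfty// ge0_fin_numE.
by apply/funext => -[x t] /=; congr pair; exact/val_inj.
Qed.

HB.instance Definition _ := Measure_isSigmaFinite.Build _ _ _ lebesgue_cons
  lebesgue_cons_sigma_finite.

End step.

Fixpoint lebesgue_tuple (n : nat) :
    {sigma_finite_measure set (n.-tuple T) -> \bar R} :=
  match n with
  | 0 => \d_([tuple] : 0.-tuple T)
  | n'.+1 => lebesgue_cons (lebesgue_tuple n')
  end.

End lebesgue_tuple.

Section euclidean.
Context {R : realType} {n : nat}.
Implicit Types (x y : 'rV[R]_n) (A K : set 'rV[R]_n).

Definition vol A : \bar R :=
  lebesgue_tuple n [set t : n.-tuple (measurableTypeR R) | A (\row_i tnth t i)].

Definition dotp x y : R := \sum_i x 0 i * y 0 i.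

(* The library's norm on 'rV[R]_n is the sup norm, so the Euclidean one is
   defined here; both induce the topology used by compact and interior. *)
Definition enorm x : R := Num.sqrt (dotp x x).

Definition eball (r : R) : set 'rV[R]_n := [set x | enorm x <= r].

Definition esphere : set 'rV[R]_n := [set x | enorm x = 1].

Definition truncated_cone A : set 'rV[R]_n :=
  [set r *: u | r in `]0, 1] & u in A].

(* The surface measure sigma of the unit sphere, given by integration in polar
   coordinates dx = r^(n-1) dr dsigma(u): sigma(A) is n times the volume of
   the cone over A truncated at radius 1. *)
Definition sphere_measure A : \bar R :=
  (n%:R%:E * vol (truncated_cone (A `&` esphere)))%E.

Definition convex_body K : Prop :=
  [/\ convex_set (K : set (convex_lmodType 'rV[R]_n)), compact K
    & interior K !=set0].

Definition symmetric_body K : Prop := forall x, K x -> K (- x).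

Definition polar K : set 'rV[R]_n := [set x | forall y, K y -> `|dotp x y| <= 1].

End euclidean.

Definition Gamma {R : realType} (a : R) : R :=
  \int[@lebesgue_measure R]_(t in `]0, +oo[) (t `^ (a - 1) * expR (- t)).

Section alpha.
Context {R : realType}.
Implicit Types (m : nat) (theta t : R) (A I S : set 'rV[R]_2).
Local Notation leb := (@lebesgue_measure R).

(* Point of the unit circle at angle t from the positive y-axis. *)
Definition circle_pt t : 'rV[R]_2 := \row_(i < 2) (if i == 0 then sin t else cos t).

Definition gweight m theta t : R := `|cos (t + theta)| ^+ (m - 1).

(* The first component of p is the radius r, the second one the angle t. *)
Definition mu2 m theta A : \bar R :=
  (\int[leb \x leb]_(p in [set p : R * R |
      [/\ 0 < p.1, 0 <= p.2 < 2 * pi & A (p.1 *: circle_pt p.2)]%R])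
    (p.1 ^+ m * gweight m theta p.2)%:E)%E.

Definition geodesic_segment I : Prop :=
  exists a b : R, [/\ a <= b, b <= a + pi & I = circle_pt @` `[a, b]].

Definition cone I : set 'rV[R]_2 := [set s *: u | s in `[0, +oo[ & u in I].

Definition arc_integral m theta I : \bar R :=
  (\int[leb]_(t in [set t | (0 <= t < 2 * pi)%R /\ I (circle_pt t)])
    (gweight m theta t)%:E)%E.

Definition alpha_quot m theta I S : \bar R :=
  if `[< exists u, I = [set u] >] then 1%E
  else (mu2 m theta (cone I `&` S) * mu2 m theta (cone I `&` polar S)
        / arc_integral m theta I ^+ 2)%E.

Definition body_class m : set (set 'rV[R]_2) :=
  [set S | [/\ convex_body S, symmetric_body S,
     eball 1 `<=` S & S `<=` eball (Num.sqrt m.+1%:R)]].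

Definition alpha_body m S : \bar R :=
  ereal_sup [set ereal_inf [set alpha_quot m theta I S | I in geodesic_segment]
            | theta in `[0, pi]].

Definition alpha m : \bar R := ereal_inf (alpha_body m @` body_class m).

End alpha.

(* Main.v *)
Require Import Defs.
From mathcomp Require Import all_boot all_order all_algebra.
From mathcomp Require Import all_classical all_reals all_analysis.
From mathcomp Require Import measurable_realfun ring lra.
Set Implicit Arguments.
Unset Strict Implicit.
Unset Printing Implicit Defensive.
Import Order.TTheory GRing.Theory Num.Theory.
Import numFieldNormedType.Exports.
Local Open Scope classical_set_scope.
Local Open Scope ring_scope.

(** Write rho_A(u) for the radius of a star-shaped set A in the direction of a
    unit vector u, B for the Euclidean unit ball, and put
    c = 2 / (sqrt n + 1). The inequality follows from two bounds that meet at
    the constant c.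

    The constant is small: alpha (n - 1) <= c^n / n^2 ([alpha_le]). Over a
    short arc around u the measures of the two sectors are, up to a small
    error, rho_S(u)^n / n and rho_S°(u)^n / n times the integral of the weight.
    The weight cancels in the quotient, so that for every theta the infimum
    over arcs is at most (rho_S(u) rho_S°(u))^n / n^2. Let S be the part of the
    disc of radius sqrt n inside a slab { |x . v| <= 1 }, v a unit vector, and
    let p be a point of norm sqrt n on the edge of the slab. In the direction u
    that bisects v and p the edge gives rho_S(u) <= 1 / (u . v), the point p
    gives rho_S°(u) <= 1 / (u . p), and the product of the two bounds is c.

    The volume product is large: vol K vol K° >= c^n vol(B)^2
    ([vol_product_ge]). A linear map does not change the volume product, so an
    inscribed ellipsoid of nearly maximal volume may be taken to be B; then
    B <= K <= r B for r slightly above sqrt n ([john_position]). Convexity alone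
    then yields rho_K(u) rho_K°(u) >= 2 / (r + 1) for all u ([polar_radial]): a
    point of K that realizes the width of K in the direction u spans with B a
    convex hull that reaches far enough along u. Finally
    n^2 vol K vol K° is the product of the integrals over the sphere of rho_K^n
    and rho_K°^n, and the Cauchy-Schwarz inequality bounds it below by the
    square of the integral of (rho_K rho_K°)^(n/2). Cutting the ball into
    finitely many cones replaces integration over the sphere
    ([vol_product_layers]).

    As the surface measure of the sphere is n vol(B), these bounds give the
    inequality. The closed form of that surface measure comes from integrating
    exp(-|x|^2) over the whole space, once coordinate by coordinate and once
    over the balls { |x|^2 <= t } ([sphere_measureE]). *)

(** * Lebesgue measure of the line under affine maps *)

Section affine_line.
Context {R : realType}.
Local Notation leb := (@lebesgue_measure R).

Lemma measurable_affine (a b : R) :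
  measurable_fun [set: measurableTypeR R]
    (fun x => a * x + b : measurableTypeR R).
Proof. by apply: measurable_funD => //; apply: measurable_funM. Qed.

(** Both sides are measures of A, so half-open intervals decide. *)
Lemma lebesgue_measure_affine (a b : R) (A : set (measurableTypeR R)) :
  a != 0 -> measurable A ->
  leb ((fun x => a * x + b) @^-1` A) = ((`|a|^-1)%:E * leb A)%E.
Proof.
move=> a0 mA; have na0 : 0 < `|a| by rewrite normr_gt0.
pose f (x : measurableTypeR R) : measurableTypeR R := a * x + b.
have mf : measurable_fun setT f by exact: measurable_affine.
pose nu := mscale (NngNum (ltW na0)) (pushforward leb f).
suff -> : leb A = nu mf A.
  rewrite /nu /mscale /= muleA -EFinM mulVf ?normr_eq0//.
  by rewrite mul1e.
apply: lebesgue_measure_unique => // _ [[x y]] _ <- /=.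
rewrite /nu /mscale /= /pushforward.
have [ag|al|ae] := ltgtP a 0; last by rewrite ae eqxx in a0.
- rewrite [X in (_ * leb X)%E](_ : _ = `[(y - b) / a, (x - b) / a[%classic); last first.
    apply/seteqP; split => z; rewrite /= /f !in_itv/= ler_ndivrMr// ltr_ndivlMr//
      [z * a]mulrC ltrBlDr lerBrDr; first by move=> /andP[-> ->].
    by move=> /andP[-> ->].
  rewrite !lebesgue_measure_itv/= !lte_fin ltr_nM2r ?invr_lt0// ltrD2r.
  case: ifP => xy; last by rewrite mule0.
  rewrite -EFinM; congr EFin; rewrite ltr0_norm//; field.
  by rewrite a0.
- rewrite [X in (_ * leb X)%E](_ : _ = `](x - b) / a, (y - b) / a]%classic); last first.
    apply/seteqP; split => z; rewrite /= /f !in_itv/= ltr_pdivrMr// ler_pdivlMr//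
      [z * a]mulrC ltrBlDr lerBrDr; first by move=> /andP[-> ->].
    by move=> /andP[-> ->].
  rewrite !lebesgue_measure_itv/= !lte_fin ltr_pM2r ?invr_gt0// ltrD2r.
  case: ifP => xy; last by rewrite mule0.
  rewrite -EFinM; congr EFin; rewrite gtr0_norm//; field.
  by rewrite a0.
Qed.
End affine_line.

(** * Volume under linear maps *)

Section borel.
Context {R : realType}.
Local Notation T := (measurableTypeR R).
Local Notation leb := (@lebesgue_measure R).

Definition vec n (t : n.-tuple T) : 'rV[R]_n := \row_i tnth t i.
Definition tup n (x : 'rV[R]_n) : n.-tuple T := [tuple x 0 i | i < n].

Lemma tupK n : cancel (@tup n) (@vec n).
Proof. by move=> x; apply/rowP => i; rewrite mxE tnth_mktuple. Qed.

Definition borel n (A : set 'rV[R]_n) : Prop := measurable (@vec n @^-1` A).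

Definition borel_fun n (f : 'rV[R]_n -> R) : Prop :=
  measurable_fun [set: n.-tuple T] (f \o @vec n : _ -> T).

Definition borel_map m n (f : 'rV[R]_m -> 'rV[R]_n) : Prop :=
  forall i, borel_fun (fun x => f x 0 i).

Lemma borel_coord n (i : 'I_n) : borel_fun (fun x => x 0 i).
Proof.
rewrite /borel_fun (_ : _ \o _ = (@tnth _ T)^~ i); last first.
  by apply/funext => t /=; rewrite mxE.
exact: measurable_tnth.
Qed.

Lemma borel_mapP m n (f : 'rV[R]_m -> 'rV[R]_n) :
  borel_map f -> measurable_fun [set: m.-tuple T] (@tup n \o f \o @vec m).
Proof.
move=> mf; apply/measurable_fun_tnthP => i.
rewrite (_ : _ \o _ = (fun x => f x 0 i) \o @vec m); first exact: mf.
by apply/funext => t /=; rewrite tnth_mktuple.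
Qed.

Lemma borel_preimage m n (f : 'rV[R]_m -> 'rV[R]_n) A :
  borel_map f -> borel A -> borel (f @^-1` A).
Proof.
move=> mf mA; rewrite /borel.
rewrite [X in measurable X](_ : _ = [set: m.-tuple T] `&` (@tup n \o f \o @vec m)
  @^-1` (@vec n @^-1` A)).
  exact: borel_mapP.
by rewrite setTI; apply/seteqP; split => t /=; rewrite tupK.
Qed.

Lemma borel_affine m n (M : 'M[R]_(m, n)) b : borel_map (fun x => x *m M + b).
Proof.
move=> i; rewrite /borel_fun.
rewrite (_ : _ \o _ = (fun t => \sum_j (vec t) 0 j * M j i + b 0 i)); last first.
  by apply/funext => t /=; rewrite !mxE.
apply: measurable_funD => //.
apply: measurable_sum => j; apply: measurable_funM => //.
exact: borel_coord.
Qed.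

Lemma vol_ge0 n (A : set 'rV[R]_n) : (0 <= vol A)%E.
Proof. exact: measure_ge0. Qed.

Lemma vec_cons n (x : T) (t : n.-tuple T) :
  vec [tuple of x :: t] = row_mx (x%:M : 'M[R]_1) (vec t).
Proof.
apply/rowP => i; rewrite !mxE; case: splitP => j ij.
  by rewrite ord1 !mxE eqxx mulr1n (tnth_nth 0)/= ij ord1.
by rewrite !mxE !(tnth_nth 0)/= ij.
Qed.

Definition cons_vec n (p : T * n.-tuple T) : 'rV[R]_n.+1 := row_mx (p.1%:M :
  'M[R]_1) (vec p.2).

Lemma volS n (A : set 'rV[R]_n.+1) :
  vol A = (leb \x lebesgue_tuple n)%E (@cons_vec n @^-1` A).
Proof.
rewrite /vol /= /lebesgue_cons /pushforward; congr (_ _).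
by apply/funext => -[x t] /=; rewrite /cons_vec -vec_cons.
Qed.

Lemma borelS n (A : set 'rV[R]_n.+1) : borel A -> measurable (@cons_vec n @^-1` A).
Proof.
move=> mA.
have h := @measurable_cons _ _ (T * n.-tuple T)%type T _ n _ measurable_fst
  measurable_snd.
have := h measurableT _ mA; rewrite setTI.
by congr measurable; apply/funext => -[x t] /=; rewrite /cons_vec -vec_cons.
Qed.

Lemma row_mx00 n (x : R) (y : 'rV[R]_n) :
  (row_mx (x%:M : 'M[R]_1) y : 'rV_(1 + n)) 0 0 = x.
Proof.
rewrite (_ : 0 = lshift n (0 : 'I_1)); last exact/val_inj.
by rewrite row_mxEl mxE.
Qed.

(** The first coordinate is integrated last, and on each fibre the map multiplies
    volumes by k. *)
Lemma vol_tail n (A : set 'rV[R]_n.+1) (f : R -> 'rV[R]_n -> 'rV[R]_n) (k : R) :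
  0 <= k -> borel A ->
  (forall x B, borel B -> vol (f x @^-1` B) = k%:E * vol B)%E ->
  vol [set v : 'rV[R]_(1 + n) | A (row_mx (lsubmx v) (f (v 0 0) (rsubmx v)))]
   = (k%:E * vol A)%E.
Proof.
move=> k0 mA fB; rewrite !volS.
have mhA := borelS mA.
rewrite /= /product_measure1 -ge0_integralZl//; last first.
  exact: measurable_fun_xsection.
apply: eq_integral => x _ /=.
pose B := [set y | A (row_mx (x%:M : 'M[R]_1) y)].
have -> : xsection (@cons_vec n @^-1` A) x = @vec n @^-1` B.
  by apply/seteqP; split => t; rewrite /xsection /= in_setE.
rewrite -/(vol B) -(fB x); last first.
  rewrite /borel (_ : _ @^-1` _ = xsection (@cons_vec n @^-1` A) x).
    exact: measurable_xsection.
  by apply/seteqP; split => t; rewrite /xsection /= in_setE.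
rewrite /vol; congr (lebesgue_tuple n _).
apply/seteqP; split => t; rewrite /xsection /= in_setE /= /cons_vec /=.
  by rewrite row_mxKl row_mxKr row_mx00.
by rewrite row_mxKl row_mxKr row_mx00.
Qed.

(** [vol_head] changes the first coordinate, so it has to be integrated first. *)
Lemma product_measure12 n (X : set (T * n.-tuple T)) : measurable X ->
  (leb \x lebesgue_tuple n)%E X = (\int[lebesgue_tuple n]_t leb (ysection X t))%E.
Proof.
move=> mX.
have := indic_fubini_tonelli leb (lebesgue_tuple n) mX.
by rewrite indic_fubini_tonelli_FE// indic_fubini_tonelli_GE.
Qed.

Lemma borel_head n (A : set 'rV[R]_n.+1) (a : R) (w : 'cV[R]_n) (c : 'M[R]_1) :
  borel A ->
  borel [set v : 'rV[R]_(1 + n) | A (row_mx (a *: lsubmx v + rsubmx v *m w + c)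
    (rsubmx v))].
Proof.
move=> mA; pose M : 'M[R]_(1 + n) := block_mx a%:M 0 w 1%:M.
have := borel_preimage (borel_affine M (row_mx c 0)) mA.
congr borel; apply/funext => v /=; congr (A _); rewrite /M.
rewrite -{1}[v]hsubmxK mul_row_block mulmx0 add0r mulmx1.
by rewrite mul_mx_scalar add_row_mx addr0.
Qed.

Lemma vol_head n (A : set 'rV[R]_n.+1) (a : R) (w : 'cV[R]_n) (c : 'M[R]_1) :
  a != 0 -> borel A ->
  vol [set v : 'rV[R]_(1 + n) | A (row_mx (a *: lsubmx v + rsubmx v *m w + c)
    (rsubmx v))]
   = (`|a|^-1%:E * vol A)%E.
Proof.
move=> a0 mA; have mhA := borelS mA.
have mA' := borel_head a w c mA.
rewrite !volS !product_measure12//; try exact: borelS.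
rewrite -ge0_integralZl//; last exact: measurable_fun_ysection.
apply: eq_integral => t _ /=.
rewrite -(@lebesgue_measure_affine _ a ((vec t *m w + c) 0 0))//;
  last exact: measurable_ysection.
have E x : row_mx (a *: (x%:M : 'M[R]_1) + vec t *m w + c) (vec t) =
           row_mx ((a * x + (vec t *m w + c) 0 0)%:M : 'M[R]_1) (vec t).
  congr row_mx; apply/matrixP => i j; rewrite !ord1 !mxE eqxx !mulr1n addrA.
  by congr (_ + _ + _); apply: eq_bigr => k _; rewrite !mxE.
by congr (leb _); apply/seteqP; split => x;
  rewrite /ysection /= !in_setE /= /cons_vec /=
  row_mxKl row_mxKr E.
Qed.

(** Needed for linear maps as well: on the fibres of an upper triangular block
    map, the map is affine. *)
Lemma vol_translate n (b : 'rV[R]_n) A : borel A ->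
  vol ((fun x => x + b) @^-1` A) = vol A.
Proof.
elim: n b A => [|n IH] b A mA.
  congr vol; apply/seteqP; split => x /=; by rewrite [x + b]thinmx0 [x]thinmx0.
pose b' : 'rV[R]_(1 + n) := b.
have := @vol_tail n _ (fun _ y => y + rsubmx b') 1 ler01
  (borel_head 1 0 (lsubmx b') mA).
rewrite (vol_head _ _ (oner_neq0 _) mA) normr1 invr1 !mul1e => <-; last first.
  by move=> _ B mB; rewrite mul1e IH.
congr vol; apply/funext => v /=; congr (A _).
rewrite row_mxKl row_mxKr scale1r mulmx0 addr0.
by rewrite -add_row_mx !hsubmxK.
Qed.

Definition scales_vol n (M : 'M[R]_n) := forall A, borel A ->
  vol ((fun x => x *m M) @^-1` A) = (`|\det M|^-1%:E * vol A)%E.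

Lemma borel_mulmx m n (M : 'M[R]_(m, n)) A : borel A ->
  borel ((fun x => x *m M) @^-1` A).
Proof.
move=> /(borel_preimage (borel_affine M 0)); congr borel.
by apply/funext => x /=; rewrite addr0.
Qed.

Lemma scales_volM n (M N : 'M[R]_n) :
  scales_vol M -> scales_vol N -> scales_vol (M *m N).
Proof.
move=> hM hN A mA; rewrite det_mulmx normrM invfM EFinM -muleA -hN//.
rewrite -hM; last exact: borel_mulmx.
by congr vol; apply/funext => x /=; rewrite mulmxA.
Qed.

Lemma scales_vol_lower n (a : R) (v : 'cV[R]_n) : a != 0 ->
  scales_vol (block_mx a%:M 0 v 1%:M : 'M[R]_(1 + n)).
Proof.
move=> a0 A mA; rewrite det_lblock det_scalar1 det1 mulr1 -(vol_head v 0 a0 mA).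
congr vol; apply/funext => x /=; congr (A _).
by rewrite -{1}[x]hsubmxK mul_row_block mulmx0 add0r mulmx1 mul_mx_scalar addr0.
Qed.

Lemma scales_vol_upper n (w : 'rV[R]_n) (S : 'M[R]_n) : scales_vol S ->
  scales_vol (block_mx 1%:M w 0 S : 'M[R]_(1 + n)).
Proof.
move=> hS A mA; rewrite det_ublock det1 mul1r.
rewrite -(@vol_tail n A (fun x y => x *: w + y *m S))//; last first.
  move=> x B mB.
  pose C := (fun y => y + x *: w) @^-1` B.
  have mC : borel C.
    have := borel_preimage (borel_affine 1%:M (x *: w)) mB.
    by congr borel; apply/funext => y; rewrite /C /= mulmx1.
  rewrite -(vol_translate (x *: w) mB) -hS//.
  by congr vol; apply/funext => y; rewrite /= addrC.
congr vol; apply/funext => x /=; congr (A _).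
rewrite -{1}[x]hsubmxK mul_row_block mulmx0 addr0 mulmx1; congr row_mx.
rewrite [lsubmx x]mx11_scalar mul_scalar_mx mxE; congr (_ *: _ + _).
by congr (x _ _); apply/val_inj.
Qed.

(** Block elimination. If the corner of M is not zero, M is the product of a
    lower and an upper triangular block matrix, which [vol_head] and [vol_tail]
    handle. If it is zero, adding a suitable row to the first one repairs it. *)
Theorem vol_mulmx n (M : 'M[R]_n) : M \in unitmx -> scales_vol M.
Proof.
elim: n M => [|n IH] M uM.
  move=> A mA; rewrite det_mx00 normr1 invr1 mul1e.
  by congr vol; apply/funext => x /=; rewrite [x *m M]thinmx0 [x]thinmx0.
(* S is the Schur complement of the corner. *)
have main (N : 'M[R]_(1 + n)) : N \in unitmx -> N 0 0 != 0 -> scales_vol N.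
  move=> uN a0; pose a := N 0 0.
  pose S := drsubmx N - dlsubmx N *m (a^-1 *: ursubmx N).
  have aE : ulsubmx N = a%:M.
    rewrite [ulsubmx N]mx11_scalar !mxE; congr ((N _ _)%:M); exact/val_inj.
  have NE : N = block_mx a%:M 0 (dlsubmx N) 1%:M *m block_mx 1%:M (a^-1 *: ursubmx
    N) 0 S.
    rewrite mulmx_block !mul0mx !mulmx0 !addr0 !mulmx1 !mul1mx /S addrCA subrr addr0.
    by rewrite mul_scalar_mx scalerA divff// scale1r -aE submxK.
  have uS : S \in unitmx.
    move: uN; rewrite {1}NE unitmx_mul => /andP[_].
    by rewrite !unitmxE det_ublock det1 mul1r.
  rewrite NE; apply: scales_volM; first exact: scales_vol_lower.
  exact/scales_vol_upper/IH.
pose N : 'M[R]_(1 + n) := M.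
have [a0|] := eqVneq (N 0 0) 0; last exact: main.
have [i vi] : exists i, dlsubmx N i 0 != 0.
  apply/existsP; apply: contraT => /existsPn h.
  have v0 : dlsubmx N = 0.
    by apply/matrixP => i j; rewrite ord1 [RHS]mxE; apply/eqP; rewrite -[_ == _]negbK h.
  have a00 : ulsubmx N = 0.
    apply/matrixP => k j; rewrite !ord1 2!mxE [RHS]mxE -a0; congr (N _ _);
      exact/val_inj.
  have d0 : \det N = 0.
    by rewrite -(submxK N) v0 a00 det_ublock det_mx11 mxE mul0r.
  by move: uM; rewrite unitmxE -[\det M]/(\det N) d0 unitr0.
(* U 1 adds the row i of the lower blocks to the first row. *)
pose U (c : R) : 'M[R]_(1 + n) := block_mx 1%:M (c *: delta_mx 0 i) 0 1%:M.
have uU c : U c \in unitmx.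
  by rewrite unitmxE det_ublock !det1 mulr1 unitr1.
have ME : M = U (- 1) *m (U 1 *m M).
  rewrite mulmxA /U mulmx_block !mul0mx !mulmx0 !addr0 !add0r !mulmx1 !mul1mx.
  by rewrite scale1r scaleN1r subrr -scalar_mx_block mul1mx.
rewrite ME; apply: scales_volM.
  apply: scales_vol_upper => A mA; rewrite det1 normr1 invr1 mul1e.
  by congr vol; apply/funext => x /=; rewrite mulmx1.
apply: (main (U 1 *m N)); first by rewrite unitmx_mul uU.
rewrite -{1}(submxK N) /U mulmx_block.
rewrite (_ : 0 = lshift n (0 : 'I_1)) ?block_mxEul; last exact/val_inj.
rewrite mul1mx mxE scale1r.
rewrite [X in X + _](_ : _ = 0) ?add0r; last first.
  by rewrite 2!mxE -a0; congr (N _ _); exact/val_inj.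
rewrite mxE (bigD1 i)//= big1 ?addr0 ?mxE ?eqxx ?mul1r//.
  by move: vi; rewrite !mxE.
by move=> j ji; rewrite mxE (negbTE ji) andbF mul0r.
Qed.
End borel.

(** * Borel sets, cubes and Euclidean balls *)

Section euclid.
Context {R : realType}.
Local Notation T := (measurableTypeR R).

(** An open set is the union of the rational boxes that it contains. *)
Lemma open_borel n (U : set 'rV[R]_n) : open U -> borel U.
Proof.
move=> oU.
pose rball (p : 'rV[rat]_n * nat) := [set y : 'rV[R]_n | forall i, `|ratr (p.1 0 i)
  - y 0 i| < p.2.+1%:R^-1].
pose F (p : 'rV[rat]_n * nat) : set 'rV[R]_n := if `[< rball p `<=` U >] then rball
  p else set0.
have UE : U = \bigcup_p F p.
  apply/seteqP; split => x; last first.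
    by move=> [p _]; rewrite /F; case: asboolP => // + px; exact.
  move=> Ux; have /nbhs_ballP[e /= e0 xeU] := open_nbhs_nbhs (conj oU Ux).
  (* The box around x of radius e / 2 > d is inside U, and the rational centre q
     is within d of x. *)
  have [k /andP[_ ke]] : exists k : nat, true && (k.+1%:R^-1 < e / 2).
    have e2 : 0 < e / 2 by rewrite divr_gt0.
    exists (Num.truncn (e / 2)^-1) => /=.
    rewrite invf_plt ?posrE//; exact: truncnS_gt.
  pose d : R := k.+1%:R^-1.
  have d0 : 0 < d by rewrite invr_gt0.
  have de : d < e / 2 by exact: ke.
  have dE : d = k.+1%:R^-1 by [].
  clearbody d; rewrite -?dE in ke *.
  have /choice[q qP] : forall i, exists q : rat, ratr q \in `]x 0 i - d, x 0 i + d[.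
    move=> i; apply: rat_in_itvoo; lra.
  pose p := (\row_i q i, k).
  have pU : rball p `<=` U.
    move=> y py; apply: xeU; split => // i j; rewrite ord1.
    have := py j; have := qP j; rewrite /= mxE in_itv/= -dE -ball_normE/=.
    by rewrite !ltr_norml => /andP[? ?] /andP[? ?]; apply/andP; split; lra.
  exists p => //; rewrite /F; case: asboolP => // _ i.
  have := qP i; rewrite in_itv/= mxE ltr_norml -dE; move=> /andP[? ?]; apply/andP;
    split; lra.
rewrite /borel UE preimage_bigcup; apply: countable_bigcupT_measurable => [|p];
  first exact: countableP.
rewrite /F; case: ifPn => _; last by rewrite preimage_set0; exact: measurable0.
rewrite (_ : _ @^-1` _ = \bigcap_(i in [set: 'I_n]) [set t : n.-tuple T | `|ratr
  (p.1 0 i) - vec t 0 i| < p.2.+1%:R^-1]); last first.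
  by apply/seteqP; split => t /= h; [move=> i _ | move=> i]; exact: h.
apply: fin_bigcap_measurable; first exact: finite_finset.
move=> i _; pose f (t : n.-tuple T) : T := `|ratr (p.1 0 i) - vec t 0 i|.
have mf : measurable_fun setT f.
  apply: measurableT_comp => //; apply: measurable_funB => //.
  exact: borel_coord.
rewrite (_ : [set _ | _] = setT `&` f @^-1` `]-oo, p.2.+1%:R^-1[%classic).
  exact: mf (measurable_itv _).
by rewrite setTI; apply/seteqP; split => t; rewrite /= in_itv.
Qed.

Lemma closed_borel n (A : set 'rV[R]_n) : closed A -> borel A.
Proof.
move=> cA; rewrite -(setCK A); apply: measurableC.
apply: (@open_borel n (~` A)); rewrite openC; exact: cA.
Qed.

Lemma vol_le n (A B : set 'rV[R]_n) :
  borel A -> borel B -> A `<=` B -> (vol A <= vol B)%E.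
Proof.
move=> mA mB AB; apply: le_measure; rewrite ?inE// => t; exact: AB.
Qed.

Definition cube n (r : R) : set 'rV[R]_n := [set x | forall i, `|x 0 i| <= r].

Lemma borel_cube n r : borel (@cube n r).
Proof.
apply: closed_borel.
rewrite (_ : cube _ = \bigcap_(i in [set: 'I_n]) [set x : 'rV[R]_n | `|x 0 i| <=
  r]); last first.
  by apply/seteqP; split => t h; [move=> i _|move=> i]; exact: h.
apply: closed_bigI => i _.
apply: (@closed_comp _ _ (fun x : 'rV[R]_n => `|x 0 i|) [set y | y <= r]);
  last exact: closed_le.
move=> x _; apply: (@continuous_comp _ _ _ (fun x : 'rV[R]_n => x 0 i) (fun z : R
  => `|z|)).
  exact: coord_continuous.
exact: norm_continuous.
Qed.

Lemma vol_cube n r : 0 <= r -> vol (@cube n r) = ((r *+ 2) ^+ n)%:E.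
Proof.
move=> r0; elim: n => [|n IH].
  rewrite expr0 /vol /= diracE mem_set// => -[]//.
rewrite volS (_ : _ @^-1` _ = `[-r, r]%classic `*` (@vec _ n @^-1` cube r)); last first.
  apply/seteqP; split => -[x t] /=.
    move=> h; split.
      have := h 0; rewrite /cons_vec/= row_mx00 /= in_itv/= ler_norml//.
    move=> i; have := h (rshift 1 i).
    by rewrite (_ : cons_vec (x, t) 0 (rshift 1 i) = vec t 0 i)//; exact: row_mxEr.
  move=> [x1 x2] i; rewrite /cons_vec /= mxE; case: splitP => j _.
    by rewrite ord1 mxE eqxx mulr1n ler_norml; rewrite in_itv in x1.
  exact: x2.
rewrite product_measure1E; [|exact: measurable_itv|exact: borel_cube].
rewrite -/(vol (cube r)) IH exprS EFinM; congr (_ * _)%E.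
rewrite [LHS]lebesgue_measure_itv /= lte_fin; case: ltP => h;
  first by rewrite -EFinD opprK.
congr EFin; suff -> : r = 0 by rewrite mul0rn.
lra.
Qed.

Lemma dotpC n (x y : 'rV[R]_n) : dotp x y = dotp y x.
Proof. by apply: eq_bigr => i _; rewrite mulrC. Qed.

Lemma dotpDl n (x y z : 'rV[R]_n) : dotp (x + y) z = dotp x z + dotp y z.
Proof. by rewrite -big_split; apply: eq_bigr => i _; rewrite mxE mulrDl. Qed.

Lemma dotpDr n (x y z : 'rV[R]_n) : dotp x (y + z) = dotp x y + dotp x z.
Proof. by rewrite dotpC dotpDl !(dotpC x). Qed.

Lemma dotpZl n a (x y : 'rV[R]_n) : dotp (a *: x) y = a * dotp x y.
Proof. by rewrite mulr_sumr; apply: eq_bigr => i _; rewrite mxE mulrA. Qed.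

Lemma dotpZr n a (x y : 'rV[R]_n) : dotp x (a *: y) = a * dotp x y.
Proof. by rewrite dotpC dotpZl dotpC. Qed.

Lemma dotpNl n (x y : 'rV[R]_n) : dotp (- x) y = - dotp x y.
Proof. by rewrite -scaleN1r dotpZl mulN1r. Qed.

Lemma dotpNr n (x y : 'rV[R]_n) : dotp x (- y) = - dotp x y.
Proof. by rewrite dotpC dotpNl dotpC. Qed.

Lemma dotp_ge0 n (x : 'rV[R]_n) : 0 <= dotp x x.
Proof. by apply: sumr_ge0 => i _; rewrite -expr2 sqr_ge0. Qed.

Lemma dotp_eq0 n (x : 'rV[R]_n) : (dotp x x == 0) = (x == 0).
Proof.
apply/idP/eqP => [|->]; last by rewrite /dotp big1// => i _; rewrite mxE mul0r.
rewrite psumr_eq0 => [/allP h|i _]; last by rewrite -expr2 sqr_ge0.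
apply/rowP => i; have := h i; rewrite mem_index_enum => /(_ isT).
by rewrite -expr2 sqrf_eq0 mxE => /eqP.
Qed.

Lemma dotp_mulmx n (x y : 'rV[R]_n) M : dotp (x *m M) y = dotp x (y *m M^T).
Proof.
have E (u v : 'rV[R]_n) : dotp u v = (u *m v^T) 0 0.
  by rewrite mxE; apply: eq_bigr => i _; rewrite mxE.
by rewrite !E trmx_mul trmxK mulmxA.
Qed.

Lemma sqr_enorm n (x : 'rV[R]_n) : enorm x ^+ 2 = dotp x x.
Proof. by rewrite sqr_sqrtr// dotp_ge0. Qed.

Lemma enorm_ge0 n (x : 'rV[R]_n) : 0 <= enorm x. Proof. exact: sqrtr_ge0. Qed.

Lemma enorm_eq0 n (x : 'rV[R]_n) : (enorm x == 0) = (x == 0).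
Proof. by rewrite -sqrf_eq0 sqr_enorm dotp_eq0. Qed.

Lemma enormZ n a (x : 'rV[R]_n) : enorm (a *: x) = `|a| * enorm x.
Proof. by rewrite /enorm dotpZl dotpZr mulrA -expr2 sqrtrM ?sqr_ge0// sqrtr_sqr. Qed.

Lemma enorm_le n (x : 'rV[R]_n) r : 0 <= r -> (enorm x <= r) = (dotp x x <= r ^+ 2).
Proof. by move=> r0; rewrite -sqr_enorm ler_sqr// nnegrE// enorm_ge0. Qed.

Lemma dotp_CS n (x y : 'rV[R]_n) : dotp x y ^+ 2 <= dotp x x * dotp y y.
Proof.
have [/eqP|y0] := boolP (dotp y y == 0).
  by move=> /eqP; rewrite dotp_eq0 => /eqP ->;
    rewrite -(scale0r 0) !dotpZr !mul0r expr0n mulr0.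
have yy : 0 < dotp y y by rewrite lt_neqAle eq_sym y0 dotp_ge0.
have := dotp_ge0 (dotp y y *: x - dotp x y *: y).
rewrite !(dotpDl, dotpDr, dotpZl, dotpZr, dotpNl, dotpNr) (dotpC y x) => h.
rewrite -(ler_pM2l yy) -subr_ge0; move: h; congr (0 <= _); ring.
Qed.

Lemma normr_dotp n (x y : 'rV[R]_n) : `|dotp x y| <= enorm x * enorm y.
Proof.
rewrite -ler_sqr ?nnegrE ?mulr_ge0 ?enorm_ge0//.
by rewrite exprMn !sqr_enorm real_normK ?num_real// dotp_CS.
Qed.

Lemma enormD n (x y : 'rV[R]_n) : enorm (x + y) <= enorm x + enorm y.
Proof.
rewrite enorm_le ?addr_ge0 ?enorm_ge0//.
rewrite !(dotpDl, dotpDr) (dotpC y x) sqrrD !sqr_enorm.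
have := normr_dotp x y; have := ler_norm (dotp x y); lra.
Qed.

Lemma coord_enorm n (x : 'rV[R]_n) i : `|x 0 i| <= enorm x.
Proof.
rewrite -ler_sqr ?nnegrE ?enorm_ge0// sqr_enorm real_normK ?num_real//.
rewrite /dotp (bigD1 i)//= -expr2 lerDl; apply: sumr_ge0 => j _.
by rewrite -expr2 sqr_ge0.
Qed.

Lemma enorm_cube n (r : R) : 0 <= r -> @cube n r `<=` eball (Num.sqrt n%:R * r).
Proof.
move=> r0 x xr; rewrite /eball /= enorm_le ?mulr_ge0// exprMn sqr_sqrtr// /dotp.
rewrite (_ : n%:R * r ^+ 2 = \sum_(i < n) r ^+ 2); last first.
  by rewrite sumr_const card_ord mulr_natl.
by apply: ler_sum => i _; rewrite -expr2 -real_normK ?num_real// ler_sqr ?nnegrE.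
Qed.

Lemma dotp_continuous n (y : 'rV[R]_n) : continuous (fun x => dotp x y).
Proof.
apply: continuous_big => [|i _]; first exact: add_continuous.
by move=> x; exact: (cvgM (@coord_continuous R 1 n 0 i x) (cvg_cst _)).
Qed.

Lemma closed_slab n (y : 'rV[R]_n) : closed [set x | `|dotp x y| <= 1].
Proof.
apply: (@closed_comp _ _ (fun x : 'rV[R]_n => `|dotp x y|) [set r | r <= 1]);
  last exact: closed_le.
move=> x _.
apply: (@continuous_comp _ _ _ (fun x : 'rV[R]_n => dotp x y) (fun z : R => `|z|)).
  exact: dotp_continuous.
exact: norm_continuous.
Qed.

Lemma closed_polar n (K : set 'rV[R]_n) : closed (polar K).
Proof.
rewrite (_ : polar K = \bigcap_(y in K) [set x | `|dotp x y| <= 1]); last first.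
  by apply/seteqP; split => x h y; exact: h.
by apply: closed_bigI => y _; exact: closed_slab.
Qed.

Lemma closed_eball n r : closed (@eball R n r).
Proof.
apply: (@closed_comp _ _ (@enorm R n) [set y | y <= r]); last exact: closed_le.
move=> x _; apply: (@continuous_comp _ _ _ (fun x : 'rV[R]_n => dotp x x) Num.sqrt).
  move: x; apply: continuous_big => [|i _ x]; first exact: add_continuous.
  exact: (cvgM (@coord_continuous R 1 n 0 i x) (@coord_continuous R 1 n 0 i x)).
exact: sqrt_continuous.
Qed.

Lemma borel_eball n r : borel (@eball R n r).
Proof. by apply: closed_borel; exact: closed_eball. Qed.

Lemma eball0 n : @eball R n 1 0.
Proof. by rewrite /eball /= (eqP (_ : enorm 0 == 0)) ?enorm_eq0. Qed.

Lemma vol_eball_fin n r : (vol (@eball R n r) < +oo)%E.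
Proof.
apply: (@le_lt_trans _ _ (vol (@cube n `|r|))); last by rewrite vol_cube// ltry.
apply: vol_le; [exact: borel_eball|exact: borel_cube|].
move=> x xr i; apply: le_trans (coord_enorm x i) _.
exact: le_trans xr (ler_norm _).
Qed.

Lemma vol_eball_gt0 n : (0 < vol (@eball R n 1))%E.
Proof.
have s0 : 0 < Num.sqrt n%:R + 1 :> R by rewrite ltr_wpDl.
apply: (@lt_le_trans _ _ (vol (@cube n (Num.sqrt n%:R + 1)^-1))).
  by rewrite vol_cube ?invr_ge0 ?(ltW s0)// lte_fin exprn_gt0// pmulrn_rgt0// invr_gt0.
apply: vol_le; [exact: borel_cube|exact: borel_eball|].
apply: subset_trans (enorm_cube _) _; first by rewrite invr_ge0 ltW.
move=> x /le_trans; apply; rewrite ler_pdivrMr// mul1r; lra.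
Qed.

Lemma vol_scale n a (A : set 'rV[R]_n) : 0 < a -> borel A ->
  vol [set a *: x | x in A] = ((a ^+ n)%:E * vol A)%E.
Proof.
move=> a0 mA.
have u : (a^-1)%:M \in @unitmx R n.
  by rewrite unitmxE det_scalar unitrX// unitfE invr_neq0// gt_eqF.
have := vol_mulmx u mA.
rewrite det_scalar normrX gtr0_norm ?invr_gt0// exprVn invrK => <-.
congr vol; apply/seteqP; split => x /=.
  move=> [y Ay <-]; rewrite mul_mx_scalar scalerA mulVf ?gt_eqF// scale1r//.
rewrite mul_mx_scalar => Ax; exists (a^-1 *: x) => //.
by rewrite scalerA divff ?gt_eqF// scale1r.
Qed.

End euclid.

(** * Convex sets that contain the unit ball *)

Section convex.
Context {R : realType}.

(** The notion [convex_set] with weights taken in R. *)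
Definition is_convex n (K : set 'rV[R]_n) := forall x y t,
  0 <= t -> t <= 1 -> K x -> K y -> K (t *: x + (1 - t) *: y).

Lemma convex_setE n (K : set 'rV[R]_n) :
  convex_set (K : set (convex_lmodType 'rV[R]_n)) <-> is_convex K.
Proof.
split=> [cK x y t t0 t1 Kx Ky|cK x y l].
  have t01 : 0 <= t <= 1 by rewrite t0 t1.
  have := cK x y (Itv01 t0 t1); rewrite !inE; exact.
rewrite !inE => Kx Ky; exact: cK.
Qed.

Lemma convex_star n (K : set 'rV[R]_n) x t : is_convex K -> K 0 ->
  0 <= t -> t <= 1 -> K x -> K (t *: x).
Proof. by move=> cK K0 t0 t1 Kx; have := cK _ _ _ t0 t1 Kx K0;
  rewrite scaler0 addr0. Qed.

(** The last hypothesis says that y = t p + (1 - t) v for some v in the unit ball. *)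
Lemma convex_hull n (K : set 'rV[R]_n) p t y :
  is_convex K -> @eball R n 1 `<=` K -> K p -> 0 <= t -> t <= 1 ->
  enorm (y - t *: p) <= 1 - t -> K y.
Proof.
move=> cK BK Kp t0; rewrite le_eqVlt => /predU1P[->|t1].
  rewrite subrr scale1r => h; suff -> : y = p by [].
  by apply/eqP; rewrite -subr_eq0 -enorm_eq0 eq_le h enorm_ge0.
have t1' : 0 < 1 - t by rewrite subr_gt0.
move=> h; rewrite (_ : y = t *: p + (1 - t) *: ((1 - t)^-1 *: (y - t *: p))).
  apply: cK => //; first exact: ltW.
  apply: BK; rewrite /eball /= enormZ gtr0_norm ?invr_gt0// mulrC.
  by rewrite ler_pdivrMr// mul1r.
by rewrite scalerA divff ?gt_eqF// scale1r addrC subrK.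
Qed.

(** The condition of [convex_hull] squared and expanded, which makes it a
    quadratic inequality in t. *)
Lemma convex_hull_sqr n (K : set 'rV[R]_n) p t y :
  is_convex K -> @eball R n 1 `<=` K -> K p -> 0 <= t -> t <= 1 ->
  dotp y y - 2 * t * dotp y p + t ^+ 2 * dotp p p <= (1 - t) ^+ 2 -> K y.
Proof.
move=> cK BK Kp t0 t1 h; apply: (convex_hull cK BK Kp t0 t1).
rewrite enorm_le ?subr_ge0//; apply: le_trans h; rewrite le_eqVlt; apply/orP; left.
rewrite !(dotpDl, dotpDr, dotpZl, dotpZr, dotpNl, dotpNr) (dotpC p y).
apply/eqP; ring.
Qed.

(** The radius of the polar body in the direction u is 1 / h for
    h = sup (u . p) over p in K, so the claim is that K reaches c h along u, for
    c = 2 / (r + 1). It does so already inside the convex hull of the unit ball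
    and a point p with u . p = h. The worst case is |p| = r with u halfway
    between p and the normal of a line through p tangent to the ball, where
    c h u lies on that line. *)
Lemma polar_radial n (K : set 'rV[R]_n) r u s :
  is_convex K -> symmetric_body K -> @eball R n 1 `<=` K -> K `<=` eball r ->
  1 < r -> enorm u = 1 -> 0 < s -> ~ K (s *: u) ->
  polar K ((2 / (r + 1) / s) *: u).
Proof.
move=> cK sK BK Kr r1 u1 s0 nK; set c := 2 / (r + 1).
have c0 : 0 < c by rewrite divr_gt0//; lra.
have cr : c * (r + 1) = 2 by rewrite /c; field; apply/eqP; lra.
have c1 : c < 1 by rewrite /c ltr_pdivrMr; lra.
have uu : dotp u u = 1 by rewrite -sqr_enorm u1 expr1n.
have K0 : K 0 by apply: BK; exact: eball0.
have main p : K p -> 0 < dotp u p -> c * dotp u p <= s.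
  move=> Kp up0; rewrite leNgt; apply/negP => sc; apply: nK.
  set h := dotp u p in up0 sc.
  have hr : h <= r.
    have := le_trans (ler_norm _) (normr_dotp u p); rewrite -/h u1 mul1r.
    by move/le_trans; apply; exact: Kr.
  have ch0 : 0 < c * h by rewrite mulr_gt0.
  suff Kch : K ((c * h) *: u).
    rewrite (_ : s *: u = (s / (c * h)) *: ((c * h) *: u)).
      apply: convex_star => //; first by rewrite divr_ge0// ltW.
      by rewrite ler_pdivrMr// mul1r ltW.
    by rewrite scalerA divfK// gt_eqF.
  have pr : dotp p p <= r ^+ 2 by rewrite -enorm_le ?(Kr p)//; lra.
  have [ch1|ch1] := leP (c * h) 1.
    by apply: BK; rewrite /eball /= enormZ u1 mulr1 gtr0_norm.
  have h1 : 1 < h by nra.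
  have q0 : 0 < r ^+ 2 - 1 by nra.
  (* For |p| = r, this t minimizes the quadratic polynomial of the hull test. *)
  pose t := (c * h ^+ 2 - 1) / (r ^+ 2 - 1).
  have tE : t * (r ^+ 2 - 1) = c * h ^+ 2 - 1 by rewrite /t divfK// gt_eqF.
  have t0 : 0 <= t by apply: divr_ge0; nra.
  have t1 : t <= 1 by rewrite /t ler_pdivrMr// mul1r; nra.
  apply: (convex_hull_sqr cK BK Kp t0 t1).
  rewrite !dotpZl !dotpZr uu -/h.
  have : t ^+ 2 * dotp p p <= t ^+ 2 * r ^+ 2 by apply: ler_wpM2l => //; exact: sqr_ge0.
  suff : (c * h) ^+ 2 - 1 <= t * (c * h ^+ 2 - 1).
    have -> : t * (c * h ^+ 2 - 1) = 2 * t * (c * h ^+ 2 - 1) - t * (t * (r ^+ 2 -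
      1)) by rewrite tE; ring.
    by move=> ? ?; lra.
  rewrite -(ler_pM2r q0) [leRHS]mulrAC tE -subr_ge0.
  have rE : r = 2 / c - 1 by apply: (mulfI (lt0r_neq0 c0));
    rewrite mulrBr mulrCA divff ?gt_eqF//; lra.
  (* The discriminant is a perfect square because r = 2 / c - 1. *)
  rewrite (_ : _ - _ = (c * h ^+ 2 + 1 - 2 / c) ^+ 2) ?sqr_ge0//.
  by rewrite rE; field; rewrite gt_eqF.
move=> p Kp; rewrite dotpZl normrM (gtr0_norm (divr_gt0 c0 s0)) mulrAC
  ler_pdivrMr// mul1r.
have [up|up|->] := ltgtP (dotp u p) 0; last by rewrite normr0 mulr0 ltW.
  by rewrite ltr0_norm// -dotpNr; apply: main; [exact: sK|rewrite dotpNr oppr_gt0].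
by rewrite gtr0_norm//; exact: main.
Qed.

(** The set of the points in the conclusion is the ellipsoid with semi-axis a
    along p and b across. By the choice of a and b, a^2/r^2 + b^2 (1 - 1/r^2) = 1:
    it touches the tangents to the unit ball through p, so it stays inside the
    convex hull of the ball and the points p and -p. *)
Lemma ellipsoid_sub n (K : set 'rV[R]_n) p r d a b x :
  is_convex K -> symmetric_body K -> @eball R n 1 `<=` K -> K p -> enorm p = r ->
  1 < r -> 0 < d -> d < 1 -> 0 < a -> 0 < b ->
  a ^+ 2 = 1 + (r ^+ 2 - 1) * d -> b ^+ 2 = 1 - d -> eball 1 x ->
  K (b *: x + ((a - b) * dotp x (r^-1 *: p)) *: (r^-1 *: p)).
Proof.
move=> cK sK BK Kp pr r1 d0 d1 a0 b0 aE bE.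
set e := r^-1 *: p.
have r0 : 0 < r by lra.
have pe : p = r *: e by rewrite /e scalerA divff ?gt_eqF// scale1r.
have ee : dotp e e = 1.
  rewrite /e dotpZl dotpZr -sqr_enorm pr; field; by rewrite gt_eqF.
clearbody e.
have q0 : 0 < r ^+ 2 - 1 by nra.
wlog x0 : x / 0 <= dotp x e => [hw|] Bx.
  have [|x0] := leP 0 (dotp x e); first by move=> /hw; exact.
  have := hw (- x); rewrite !dotpNl scalerN mulrN scaleNr -opprD oppr_ge0 => /(_
    (ltW x0)) h.
  rewrite -[X in K X]opprK; apply: sK; apply: h.
  by move: Bx; rewrite /eball /= -scaleN1r enormZ normrN1 mul1r.
set x1 := dotp x e in x0 *; set y := _ + _.
have xx : dotp x x <= 1 by rewrite -(expr1n _ 2) -enorm_le.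
have x11 : x1 <= 1.
  have := dotp_CS x e; rewrite -/x1 ee mulr1; nra.
have yy : dotp y y <= 1 - d + d * r ^+ 2 * x1 ^+ 2.
  rewrite /y !(dotpDl, dotpDr, dotpZl, dotpZr) (dotpC e x) ee -/x1.
  have -> : 1 - d + d * r ^+ 2 * x1 ^+ 2 = b ^+ 2 + (a ^+ 2 - b ^+ 2) * x1 ^+ 2 by
    rewrite aE bE; ring.
  have : b ^+ 2 * dotp x x <= b ^+ 2 by rewrite ler_piMr// sqr_ge0.
  nra.
have ye : dotp y e = a * x1.
  by rewrite /y !(dotpDl, dotpZl) ee -/x1; ring.
pose z := r * (a * x1).
have z0 : 0 <= z by rewrite /z !mulr_ge0// ltW.
have zE : a ^+ 2 * (r ^+ 2 * x1 ^+ 2) = z ^+ 2 by rewrite /z; ring.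
have a1 : 1 < a by nra.
have [z1|z1] := leP z 1.
  apply: BK; rewrite /eball /= enorm_le// expr1n; apply: le_trans yy _.
  suff : r ^+ 2 * x1 ^+ 2 <= 1 by nra.
  by have : a ^+ 2 * (r ^+ 2 * x1 ^+ 2) <= 1; [rewrite zE; nra|nra].
(* Again the minimizer of the quadratic polynomial; z = y . p. *)
pose t := (z - 1) / (r ^+ 2 - 1).
have tE : t * (r ^+ 2 - 1) = z - 1 by rewrite /t divfK// gt_eqF.
have t0 : 0 <= t by apply: divr_ge0; lra.
have ar : a <= r by rewrite -ler_sqr ?nnegrE ?ltW// aE; nra.
have t1 : t <= 1.
  rewrite /t ler_pdivrMr// mul1r /z; apply: lerB => //.
  rewrite expr2 ler_pM2l//; apply: le_trans ar; rewrite ler_piMr// ltW//.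
apply: (convex_hull_sqr cK BK Kp t0 t1).
have -> : dotp y p = z by rewrite pe dotpZr ye.
rewrite -[dotp p p]sqr_enorm pr.
suff : dotp y y - 1 <= t * (z - 1).
  have -> : t * (z - 1) = 2 * t * (z - 1) - t * (t * (r ^+ 2 - 1)) by rewrite tE; ring.
  by move=> ?; lra.
apply: (@le_trans _ _ (d * (r ^+ 2 * x1 ^+ 2 - 1))); first by nra.
have a20 : 0 < a ^+ 2 by rewrite exprn_gt0.
rewrite -(ler_pM2l a20) -(ler_pM2r q0).
have -> : a ^+ 2 * (d * (r ^+ 2 * x1 ^+ 2 - 1)) * (r ^+ 2 - 1) =
  (a ^+ 2 - 1) * (z ^+ 2 - a ^+ 2) by rewrite -zE aE; ring.
rewrite (_ : a ^+ 2 * (t * (z - 1)) * (r ^+ 2 - 1) = a ^+ 2 * (z - 1) ^+ 2); last first.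
  by transitivity (a ^+ 2 * ((z - 1) * (t * (r ^+ 2 - 1)))); [ring|rewrite tE; ring].
rewrite -subr_ge0 (_ : _ - _ = (z - a ^+ 2) ^+ 2) ?sqr_ge0//; ring.
Qed.

(** Factor the block matrix with rows (1, v) and (-u, 1) in two ways. *)
Lemma det_rank1_update n (u : 'cV[R]_n) (v : 'rV[R]_n) :
  \det (1%:M + u *m v) = 1 + (v *m u) 0 0.
Proof.
pose L : 'M[R]_(1 + n) := block_mx 1%:M 0 (- u) 1%:M.
have E1 : L *m block_mx 1%:M v 0 (1%:M + u *m v) = block_mx 1%:M v (- u) 1%:M.
  by rewrite mulmx_block !mul0mx !mul1mx !mulmx1 !addr0 mulNmx addrCA addNr addr0.
have E2 : block_mx (1%:M + v *m u) v 0 1%:M *m L = block_mx 1%:M v (- u) 1%:M.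
  by rewrite mulmx_block !mul0mx !mul1mx !mulmx1 !mulmx0 !add0r mulmxN addrK.
have := congr1 determinant E1; rewrite -E2 !det_mulmx det_lblock !det1 !mul1r.
by rewrite det_ublock det1 mul1r det_ublock det1 !mulr1 det_mx11 !mxE.
Qed.

End convex.

(** * Volume product of a body between two balls *)

Section layers.
Context {R : realType}.
Local Notation T := (measurableTypeR R).

(** Summing 2 t <= t^2 a + 1/a with weights w gives 2 t W <= t^2 X + Y for all
    t; then t = W / X. *)
Lemma weighted_cauchy_schwarz N (w a : 'I_N -> R) : (forall i, 0 <= w i) ->
  (forall i, 0 < a i) ->
  (\sum_i w i) ^+ 2 <= (\sum_i a i * w i) * (\sum_i (a i)^-1 * w i).
Proof.
move=> w0 a0; set W := \sum_i w i; set X := \sum_i a i * w i;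
  set Y := \sum_i (a i)^-1 * w i.
have X0 : 0 <= X by apply: sumr_ge0 => i _; rewrite mulr_ge0// ltW.
have Y0 : 0 <= Y by apply: sumr_ge0 => i _; rewrite mulr_ge0// invr_ge0 ltW.
have key t : 2 * t * W <= t ^+ 2 * X + Y.
  rewrite /W /X /Y !mulr_sumr -big_split; apply: ler_sum => i _ /=.
  rewrite mulrA -mulrDl; apply: ler_wpM2r => //.
  have ai := a0 i.
  rewrite -subr_ge0 (_ : _ - _ = (t * a i - 1) ^+ 2 * (a i)^-1).
    by rewrite mulr_ge0 ?sqr_ge0// invr_ge0 ltW.
  by field; rewrite gt_eqF.
have [X00|X0'] := eqVneq X 0; last first.
  have Xp : 0 < X by rewrite lt_neqAle eq_sym X0'.
  have := key (W / X); rewrite -(ler_pM2r Xp) => h.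
  rewrite -subr_ge0; move: h; rewrite -subr_ge0; congr (0 <= _); field.
  exact: X0'.
suff -> : W = 0 by rewrite expr0n mulr_ge0.
apply: big1 => i _.
have : a i * w i = 0.
  apply/eqP; have := X00; rewrite /X => /eqP; rewrite psumr_eq0.
    by move=> /allP/(_ i); rewrite mem_index_enum => /(_ isT).
  by move=> j _; rewrite mulr_ge0// ltW.
by move=> /eqP; rewrite mulf_eq0 gt_eqF//= => /eqP.
Qed.

Definition unit_dir n (x : 'rV[R]_n) := (enorm x)^-1 *: x.

(** Writing the inverse norm as |x|^2 to the power -1/2 reduces measurability
    to that of a real power. *)
Lemma borel_unit_dir n : borel_map (@unit_dir n).
Proof.
move=> i; rewrite /borel_fun.
rewrite (_ : _ \o _ = fun t => (dotp (vec t) (vec t)) `^ (- 2^-1) * (vec t 0 i));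
  last first.
  apply/funext => t /=; rewrite mxE; congr (_ * _).
  by rewrite /enorm powRN -powR12_sqrt// dotp_ge0.
apply: measurable_funM; last exact: borel_coord.
apply: (@measurableT_comp _ _ _ _ _ _ (fun x : T => x `^ (- 2^-1))).
  exact: measurable_powR.
rewrite /dotp; apply: measurable_sum => j.
by apply: measurable_funM; exact: borel_coord.
Qed.

Lemma unit_dirZ n s (x : 'rV[R]_n) : 0 < s -> unit_dir (s *: x) = unit_dir x.
Proof.
move=> s0; rewrite /unit_dir enormZ gtr0_norm// scalerA invfM mulrAC mulVf ?mul1r//.
by rewrite gt_eqF.
Qed.

Lemma enorm_unit_dir n (x : 'rV[R]_n) : x != 0 -> enorm (unit_dir x) = 1.
Proof.
move=> x0; have e0 : 0 < enorm x by rewrite lt_neqAle eq_sym enorm_eq0 x0 enorm_ge0.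
by rewrite /unit_dir enormZ gtr0_norm ?invr_gt0// mulVf// gt_eqF.
Qed.

Lemma unit_dirE n (x : 'rV[R]_n) : x != 0 -> x = enorm x *: unit_dir x.
Proof. by move=> x0; rewrite /unit_dir scalerA divff ?scale1r// enorm_eq0. Qed.

Lemma vol_bigcup n N (F : 'I_N -> set 'rV[R]_n) :
  (forall i, borel (F i)) -> trivIset setT F ->
  vol (\bigcup_i F i) = (\sum_(i < N) vol (F i))%E.
Proof.
move=> mF tF; rewrite /vol.
have := @measure_bigsetU_ord _ _ _ (lebesgue_tuple n) N xpredT (fun i => @vec _ n
  @^-1` (F i)) mF.
move=> <-; last first.
  by apply/trivIsetP => i j _ _ ij; rewrite -preimage_setI;
    move/trivIsetP: tF => ->//; rewrite preimage_set0.
congr (lebesgue_tuple n _); rewrite -bigcup_seq.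
by apply/seteqP; split => t /= [i _ Fi]; exists i => //=; rewrite mem_index_enum.
Qed.

Lemma vol_set0 n : vol (set0 : set 'rV[R]_n) = 0%E.
Proof. by rewrite /vol measure0. Qed.

Lemma borelI n (A B : set 'rV[R]_n) : borel A -> borel B -> borel (A `&` B).
Proof. exact: measurableI. Qed.

Lemma borelD n (A B : set 'rV[R]_n) : borel A -> borel B -> borel (A `\` B).
Proof. exact: measurableD. Qed.

Lemma borel_scale n a (A : set 'rV[R]_n) : 0 < a -> borel A ->
  borel [set a *: x | x in A].
Proof.
move=> a0 mA.
have := borel_mulmx (a^-1)%:M mA; congr borel.
apply/seteqP; split => x /=; rewrite ?mul_mx_scalar.
  by move=> Ax; exists (a^-1 *: x) => //; rewrite scalerA divff ?gt_eqF// scale1r.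
by move=> [y Ay <-]; rewrite scalerA mulVf ?gt_eqF// scale1r.
Qed.

(** A discrete substitute for the volume in polar coordinates: A contains the
    disjoint sets a_i (B \cap D_i), and the volume scales by a_i^n. *)
Lemma vol_cones_le n N (D : 'I_N -> set 'rV[R]_n) (a : 'I_N -> R) A :
  (forall i, borel (D i)) -> (forall i x s, 0 < s -> D i x -> D i (s *: x)) ->
  trivIset setT D -> (forall i, 0 < a i) -> borel A ->
  (forall i x, D i x -> enorm x <= 1 -> A (a i *: x)) ->
  (\sum_(i < N) (a i ^+ n)%:E * vol (eball 1 `&` D i) <= vol A)%E.
Proof.
move=> mD Ds tD a0 mA DA.
have mF i : borel [set a i *: x | x in eball 1 `&` D i].
  by apply: borel_scale => //; apply: borelI => //; exact: borel_eball.
have tF : trivIset setT (fun i => [set a i *: x | x in eball 1 `&` D i]).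
  apply/trivIsetP => i j _ _ ij; apply/seteqP; split => // _ [[x [_ Dx] <-]].
  move=> [y [_ Dy] yx].
  by have /trivIsetP/(_ i j I I ij) := tD => <-; split; [exact: Ds|rewrite -yx;
    exact: Ds].
apply: (@le_trans _ _ (vol (\bigcup_i [set a i *: x | x in eball 1 `&` D i]))).
  rewrite vol_bigcup//; apply: lee_sum => i _.
  rewrite -vol_scale//; apply: borelI => //; exact: borel_eball.
apply: vol_le => //.
  rewrite /borel preimage_bigcup; apply: fin_bigcup_measurable.
    exact: finite_finset.
  by move=> i _; exact: mF.
by move=> _ [i _] [x [x1 Dx] <-]; exact: DA.
Qed.

(** Bernoulli's inequality. *)
Lemma expr_unbounded (l r : R) : 1 < l -> exists N, r < l ^+ N.
Proof.
move=> l1.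
have B N : 1 + N%:R * (l - 1) <= l ^+ N.
  elim: N => [|N IH]; first by rewrite mul0r addr0 expr0.
  rewrite exprS; have NN : (0 : R) <= N%:R by [].
  have l0 : 0 <= l by lra.
  rewrite -natr1; apply: le_trans (ler_wpM2l l0 IH); rewrite -subr_ge0.
  rewrite (_ : _ - _ = N%:R * (l - 1) ^+ 2); first by rewrite mulr_ge0// sqr_ge0.
  ring.
exists (Num.truncn (`|r| / (l - 1))).+1.
apply: lt_le_trans (B _).
have l0 : 0 < l - 1 by rewrite subr_gt0.
have := truncnS_gt (`|r| / (l - 1)); rewrite ltr_pdivrMr// => h.
have := ler_norm r; lra.
Qed.

(** The origin has no direction, so the cones below do not cover it. *)
Definition punctured_ball n : set 'rV[R]_n := eball 1 `\` [set 0].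

Lemma borel0 n : borel [set (0 : 'rV[R]_n)].
Proof.
rewrite (_ : [set 0] = cube 0); first exact: borel_cube.
apply/seteqP; split => x /=; first by move=> -> i; rewrite mxE normr0.
move=> h; apply/rowP => i; rewrite mxE.
by apply/eqP; rewrite -normr_le0; exact: h.
Qed.

Lemma borel_punctured_ball n : borel (@punctured_ball n).
Proof. by apply: borelD; [exact: borel_eball|exact: borel0]. Qed.

Lemma vol_punctured_ball_fin n : vol (@punctured_ball n) \is a fin_num.
Proof.
rewrite ge0_fin_numE ?vol_ge0//.
apply: le_lt_trans (vol_eball_fin n 1); apply: vol_le;
  [exact: borel_punctured_ball|exact: borel_eball|].
by move=> x [].
Qed.

(** The ball is cut into the cones D_i where l^i <= rho_K < l^(i+1). On D_i the
    body K has radius at least l^i, and K° has radius at least c / l^(i+1) by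
    [polar_radial]. The Cauchy-Schwarz inequality for the volumes of the
    B \cap D_i then yields the bound, up to a factor l^n for the thickness of the
    layers. *)
Lemma vol_product_layers n (K : set 'rV[R]_n) r l : is_convex K ->
  symmetric_body K -> borel K ->
  eball 1 `<=` K -> K `<=` eball r -> 1 < r -> 1 < l ->
  (((2 / (r + 1) / l) ^+ n)%:E * vol (@punctured_ball n) ^+ 2 <= vol K * vol (polar
    K))%E.
Proof.
move=> cK sK mK BK Kr r1 l1; set c := 2 / (r + 1).
have c0 : 0 < c by rewrite divr_gt0//; lra.
have l0 : 0 < l by lra.
have mPK := closed_borel (@closed_polar _ n K).
have K0 : K 0 by apply: BK; exact: eball0.
have starP x t : 0 <= t -> t <= 1 -> polar K x -> polar K (t *: x).
  move=> t0 t1 Kx y Ky; rewrite dotpZl normrM ger0_norm//.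
  by apply: mulr_ile1 => //; exact: Kx.
have [N rN] := expr_unbounded r l1.
pose E i := [set x : 'rV[R]_n | K (l ^+ i *: unit_dir x)].
have mE i : borel (E i).
  have m1 : borel ((fun x => x *m (l ^+ i)%:M) @^-1` K) by exact: borel_mulmx.
  have := borel_preimage (@borel_unit_dir n) m1.
  by congr borel; apply/funext => x /=; rewrite mul_mx_scalar.
have Ele i j : (i <= j)%N -> E j `<=` E i.
  move=> ij x Ejx; rewrite /E /=.
  rewrite (_ : l ^+ i *: unit_dir x = (l ^- (j - i)) *: (l ^+ j *: unit_dir x)).
    apply: convex_star => //; first by rewrite invr_ge0 exprn_ge0// ltW.
    by rewrite invf_le1 ?exprn_gt0// exprn_ege1// ltW.
  have jE : l ^+ j = l ^+ (j - i) * l ^+ i by rewrite -exprD subnK.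
  rewrite [RHS]scalerA jE mulrA mulVf ?mul1r//.
  by rewrite expf_neq0// gt_eqF.
pose D (i : 'I_N) := (E i `\` E i.+1) `\` [set 0].
have mD i : borel (D i) by apply: borelD; [exact: borelD|exact: borel0].
have Ds i x s : 0 < s -> D i x -> D i (s *: x).
  move=> s0 [[E1 E2] x0]; split; last first.
    by move=> /= /eqP; rewrite scaler_eq0 gt_eqF//= => /eqP.
  by split; [move: E1|move: E2]; rewrite /E /= unit_dirZ.
have tD : trivIset setT D.
  apply/trivIsetP => i j _ _ ij; apply/seteqP; split => //
    x [[[Ei nEi] _] [[Ej nEj] _]].
  case: (ltngtP i j) => h.
  - by apply: nEi; exact: (Ele i.+1 j).
  - by apply: nEj; exact: (Ele j.+1 i).
  - by move/eqP: ij; apply; exact/val_inj.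
pose w i := vol (@eball R n 1 `&` D i).
have DE : @punctured_ball n = \bigcup_i (@eball R n 1 `&` D i).
  apply/seteqP; split => x; last by move=> [i _] [x1 [_ x0]].
  move=> [x1 x0].
  have u1 : enorm (unit_dir x) = 1 by apply: enorm_unit_dir; exact/eqP.
  have E0 : E 0%N x by apply: BK; rewrite /eball /= expr0 scale1r u1.
  have EN : ~ E N x.
    move=> /Kr; rewrite /eball /= enormZ u1 mulr1 gtr0_norm ?exprn_gt0//.
    by rewrite leNgt rN.
  (* The layer of x is the last i with x in E i. *)
  have [i iN [Ei nEi]] : exists2 i, (i < N)%N & E i x /\ ~ E i.+1 x.
    apply: contrapT => h; apply: EN.
    suff : forall i, (i <= N)%N -> E i x by exact.
    elim=> // i IH iN; apply: contrapT => nEi; apply: h; exists i => //.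
    by split=> //; apply: IH; exact: ltnW.
  by exists (Ordinal iN).
have mW i : borel (@eball R n 1 `&` D i) by apply: borelI => //; exact: borel_eball.
have volE : vol (@punctured_ball n) = (\sum_(i < N) w i)%E.
  rewrite DE vol_bigcup//; apply/trivIsetP => i j _ _ ij.
  by rewrite setIACA (iffLR trivIsetP tD)// setI0.
have wfin i : w i \is a fin_num.
  rewrite ge0_fin_numE ?vol_ge0//; apply: le_lt_trans (vol_eball_fin n 1).
  by apply: vol_le; [exact: mW|exact: borel_eball|move=> x []].
pose a (i : 'I_N) := l ^+ i.
have a0 i : 0 < a i by rewrite exprn_gt0.
have star x t : 0 <= t -> t <= 1 -> K x -> K (t *: x) by exact: convex_star.
have h1 : (\sum_(i < N) (a i ^+ n)%:E * w i <= vol K)%E.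
  apply: vol_cones_le => // i x [[Ex _] x0] x1.
  rewrite [x]unit_dirE; last exact/eqP.
  by rewrite scalerA mulrC -scalerA; apply: star => //; exact: enorm_ge0.
have h2 : (\sum_(i < N) ((c / (a i * l)) ^+ n)%:E * w i <= vol (polar K))%E.
  apply: vol_cones_le => //.
    by move=> i; rewrite divr_gt0// mulr_gt0.
  move=> i x [[_ nEx] x0] x1.
  rewrite [x]unit_dirE; last exact/eqP.
  rewrite scalerA mulrC -scalerA; apply: starP => //; first exact: enorm_ge0.
  apply: (polar_radial cK sK BK Kr) => //; first by apply: enorm_unit_dir; exact/eqP.
    by rewrite mulr_gt0.
  by rewrite /a -exprSr.
apply: le_trans (lee_pmul _ _ h1 h2); last 2 first.
  by apply: sume_ge0 => i _; rewrite mule_ge0 ?vol_ge0// lee_fin exprn_ge0// ltW.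
  by apply: sume_ge0 => i _; rewrite mule_ge0 ?vol_ge0// lee_fin exprn_ge0// ltW//
    divr_gt0// mulr_gt0.
pose v i := fine (w i).
have wv i : w i = (v i)%:E by rewrite fineK.
rewrite volE; under eq_bigr do rewrite wv.
under [in leRHS]eq_bigr do rewrite wv -EFinM.
under [X in (_ <= _ * X)%E]eq_bigr do rewrite wv -EFinM.
rewrite !sumEFin -EFin_expe -!EFinM lee_fin.
have := @weighted_cauchy_schwarz N v (fun i => a i ^+ n).
have cl0 : 0 < (c / l) ^+ n by rewrite exprn_gt0// divr_gt0.
rewrite -(ler_pM2l cl0) => /(_ _ _)/le_trans; apply.
- by move=> i; rewrite fine_ge0// vol_ge0.
- by move=> i; rewrite exprn_gt0.
rewrite mulrCA; apply: ler_wpM2l.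
  apply: sumr_ge0 => i _; apply: mulr_ge0; first exact/exprn_ge0/ltW.
  by rewrite fine_ge0// vol_ge0.
rewrite mulr_sumr; apply: ler_sum => i _; rewrite mulrA; apply: ler_wpM2r.
  by rewrite fine_ge0// vol_ge0.
by rewrite -exprVn -exprMn [a i * l]mulrC invfM mulrA.
Qed.
End layers.

(** * Nearly maximal inscribed ellipsoids *)

Section john.
Context {R : realType}.

Definition pullback n (K : set 'rV[R]_n) (M : 'M[R]_n) := (fun x => x *m M) @^-1` K.

Lemma is_convex_pullback n (K : set 'rV[R]_n) M : is_convex K ->
  is_convex (pullback K M).
Proof.
move=> cK x y t t0 t1 Kx Ky; rewrite /pullback /= mulmxDl -!scalemxAl; exact: cK.
Qed.

Lemma symmetric_pullback n (K : set 'rV[R]_n) M : symmetric_body K ->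
  symmetric_body (pullback K M).
Proof. by move=> sK x Kx; rewrite /pullback /= mulNmx; exact: sK. Qed.

(** Duality turns a linear map into its inverse transpose. *)
Lemma polar_pullback n (K : set 'rV[R]_n) M : M \in unitmx ->
  polar (pullback K M) = pullback (polar K) (invmx M)^T.
Proof.
move=> uM; apply/seteqP; split => x h y Ky.
  rewrite dotp_mulmx trmxK; apply: h; rewrite /pullback /=.
  by rewrite -mulmxA mulVmx// mulmx1.
have := h (y *m M) Ky; rewrite dotp_mulmx trmxK.
by rewrite -mulmxA mulmxV// mulmx1.
Qed.

Lemma vol_product_pullback n (K : set 'rV[R]_n) M : borel K -> M \in unitmx ->
  (vol (pullback K M) * vol (polar (pullback K M)) = vol K * vol (polar K))%E.
Proof.
move=> mK uM; rewrite polar_pullback// /pullback !vol_mulmx//; last 2 first.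
- by rewrite unitmx_tr unitmx_inv.
- by apply: closed_borel; exact: closed_polar.
rewrite det_tr det_inv normfV invrK muleACA -EFinM mulVf ?mul1e//.
by rewrite normr_eq0 -unitfE -unitmxE.
Qed.

Lemma bernoulli_ge (d : R) k : 0 <= d -> d <= 1 -> 1 - k%:R * d <= (1 - d) ^+ k.
Proof.
move=> d0 d1; elim: k => [|k IH]; first by rewrite mul0r subr0 expr0.
have k0 : (0 : R) <= k%:R by [].
have d1' : 0 <= 1 - d by lra.
rewrite exprS; apply: le_trans (ler_wpM2l d1' IH); rewrite -natr1 -subr_ge0.
rewrite (_ : _ - _ = k%:R * d ^+ 2); first by rewrite mulr_ge0// sqr_ge0.
ring.
Qed.

(** The ellipsoid of [ellipsoid_sub] has volume a b^k times that of the ball in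
    dimension k + 1. To first order in d the square of that factor is
    1 + (r^2 - (k + 1)) d, so a small d makes it larger than 1. *)
Lemma john_stretch_factor (k : nat) (r : R) : (0 < k)%N -> k.+1%:R < r ^+ 2 ->
  exists d a b : R, [/\ 0 < d < 1, 0 < a, 0 < b,
    a ^+ 2 = 1 + (r ^+ 2 - 1) * d & b ^+ 2 = 1 - d] /\ 1 < a * b ^+ k.
Proof.
move=> k0 kr; set q := r ^+ 2 - 1.
have k1 : (1 : R) <= k%:R by rewrite ler1n.
have qk : 0 < q - k%:R by rewrite /q; move: kr; rewrite -natr1; lra.
have q0 : 0 < q by lra.
have qk1 : 0 < q * (k%:R + 1) by rewrite mulr_gt0//; lra.
pose d := (q - k%:R) / (q * (k%:R + 1)).
have dE : d * (q * (k%:R + 1)) = q - k%:R by rewrite /d divfK// gt_eqF.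
have d0 : 0 < d by rewrite divr_gt0.
have d1 : d < 1 by rewrite ltr_pdivrMr// mul1r; nra.
have a0 : 0 < 1 + q * d by nra.
have b0 : 0 < 1 - d by lra.
exists d, (Num.sqrt (1 + q * d)), (Num.sqrt (1 - d)).
split; first by split; rewrite ?d0 ?d1 ?sqrtr_gt0 ?sqr_sqrtr// ltW.
rewrite -ltr_sqr ?nnegrE ?mulr_ge0 ?exprn_ge0 ?sqrtr_ge0// expr1n exprMn exprAC.
rewrite !sqr_sqrtr ?ltW//.
have := ler_wpM2l (ltW a0) (bernoulli_ge k (ltW d0) (ltW d1)); apply: lt_le_trans.
rewrite -subr_gt0 -(pmulr_lgt0 _ qk1).
have -> : ((1 + q * d) * (1 - k%:R * d) - 1) * (q * (k%:R + 1)) =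
  (d * (q * (k%:R + 1))) * (q - k%:R) - (d * (q * (k%:R + 1))) * (d * (q * k%:R))
    by ring.
rewrite dE -mulrBr; apply: mulr_gt0 => //.
have kd : d * (q * k%:R) * (k%:R + 1) = (q - k%:R) * k%:R by rewrite -dE; ring.
rewrite -(pmulr_lgt0 _ (_ : 0 < k%:R + 1)); last by lra.
by rewrite mulrBl kd -mulrBr mulr_gt0//; lra.
Qed.

Lemma stretch_mxE n (e x : 'rV[R]_n) (a b : R) :
  x *m (b%:M + (a - b) *: (e^T *m e)) = b *: x + ((a - b) * dotp x e) *: e.
Proof.
rewrite mulmxDr mul_mx_scalar -scalemxAr mulmxA [x *m e^T]mx11_scalar mul_scalar_mx
  scalerA.
by congr (_ + (_ * _) *: _); rewrite mxE; apply: eq_bigr => i _; rewrite mxE.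
Qed.

Lemma det_stretch k (e : 'rV[R]_k.+1) (a b : R) : dotp e e = 1 -> b != 0 ->
  \det (b%:M + (a - b) *: (e^T *m e)) = a * b ^+ k.
Proof.
move=> ee b0.
have -> : b%:M + (a - b) *: (e^T *m e) = b *: (1%:M + (b^-1 * (a - b)) *: e^T *m e).
  by rewrite scalerDr [in RHS]scalemxAl scalerA mulrA divff// mul1r -scalemxAl scalemx1.
rewrite detZ det_rank1_update -scalemxAr mxE.
have -> : (e *m e^T) 0 0 = 1 by rewrite -ee mxE; apply: eq_bigr => i _; rewrite mxE.
by rewrite mulr1 exprSr; field.
Qed.

(** The volumes of the ellipsoids inscribed in K are bounded; take one within
    the factor a b^k of [john_stretch_factor] of their supremum, and take it to
    be the unit ball. A point of K at distance more than r would allow a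
    stretched ellipsoid ([ellipsoid_sub]) whose volume exceeds the supremum.
    Because r^2 exceeds the dimension strictly, an ellipsoid of nearly maximal
    volume is enough. *)
Lemma john_position k (K : set 'rV[R]_k.+1) r e : (0 < k)%N -> k.+1%:R < r ^+ 2 ->
  1 < r ->
  is_convex K -> symmetric_body K -> borel K -> (vol K < +oo)%E ->
  0 < e -> eball e `<=` K ->
  exists2 M, M \in unitmx & eball 1 `<=` pullback K M /\ pullback K M `<=` eball r.
Proof.
move=> k0 kr r1 cK sK mK Kfin e0 eK.
have [d [a [b [[/andP[d0 d1] a0 b0 aE bE] ab1]]]] := john_stretch_factor k0 kr.
pose S := [set `|\det M| | M in [set M : 'M[R]_k.+1 | M \in unitmx /\
  eball 1 `<=` pullback K M]].
have S0 : S !=set0.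
  exists `|\det (e%:M : 'M[R]_k.+1)|, e%:M => //; split.
    by rewrite unitmxE det_scalar unitrX// unitfE gt_eqF.
  move=> x Bx; apply: eK; rewrite /eball /= mul_mx_scalar enormZ gtr0_norm//.
  by rewrite ler_piMr// ltW.
have V0 := @vol_eball_gt0 R k.+1.
have Vf : vol (@eball R k.+1 1) \is a fin_num by rewrite ge0_fin_numE ?vol_ge0//
  vol_eball_fin.
pose V := fine (vol (@eball R k.+1 1)).
have VE : vol (@eball R k.+1 1) = V%:E by rewrite fineK.
have V0' : 0 < V by rewrite -lte_fin -VE.
have KE : vol K = (fine (vol K))%:E by rewrite fineK// ge0_fin_numE// vol_ge0.
have supS : has_sup S.
  split => //; exists (fine (vol K) / V) => _ [M [uM BM] <-].
  rewrite ler_pdivlMr// -lee_fin EFinM -VE -KE.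
  have dM : 0 < `|\det M| by rewrite normr_gt0 -unitfE -unitmxE.
  have := vol_le (borel_eball _) (borel_mulmx M mK) BM.
  rewrite (vol_mulmx uM mK) => h.
  have dM' : (0 <= `|\det M|%:E)%E by rewrite lee_fin ltW.
  apply: le_trans (lee_wpmul2l dM' h) _.
  by rewrite muleA -EFinM divff ?gt_eqF// mul1e.
have s0 : 0 < sup S.
  have [x [M [uM BM] Mx]] := S0.
  apply: (@lt_le_trans _ _ x); first by rewrite -Mx normr_gt0 -unitfE -unitmxE.
  by apply: sup_upper_bound => //; exists M.
have ab0 : 0 < a * b ^+ k by rewrite mulr_gt0// exprn_gt0.
have lts : sup S / (a * b ^+ k) < sup S by rewrite ltr_pdivrMr// ltr_pMr.
have eps0 : 0 < sup S - sup S / (a * b ^+ k) by rewrite subr_gt0.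
have [_ [M [uM BM] <-]] := sup_adherent eps0 supS.
rewrite opprB addrC subrK => sM.
exists M => //; split => // p Kp; rewrite /eball /= leNgt; apply/negP => rp.
have r0 : 0 < r by lra.
have p0 : 0 < enorm p by exact: lt_trans rp.
have cKM := @is_convex_pullback _ _ M cK; have sKM := @symmetric_pullback _ _ M sK.
pose p' := (r / enorm p) *: p.
have Kp' : pullback K M p'.
  apply: convex_star => //.
  - by apply: BM; exact: eball0.
  - by rewrite divr_ge0// ltW.
  - by rewrite ler_pdivrMr// mul1r ltW.
have p'r : enorm p' = r by rewrite /p' enormZ gtr0_norm ?divr_gt0// divfK// gt_eqF.
pose u := r^-1 *: p'.
have uu : dotp u u = 1 by rewrite -sqr_enorm /u enormZ p'r gtr0_norm ?invr_gt0//
  mulVf ?expr1n// gt_eqF.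
pose D := b%:M + (a - b) *: (u^T *m u).
have dD : \det D = a * b ^+ k by rewrite /D det_stretch// gt_eqF.
(* D stretches the unit ball along u and multiplies volumes by a b^k. *)
have : `|\det (D *m M)| <= sup S.
  apply: sup_upper_bound => //; exists (D *m M) => //; split.
    by rewrite unitmx_mul uM andbT unitmxE dD unitfE gt_eqF.
  move=> x Bx; rewrite /pullback /= mulmxA /D stretch_mxE.
  exact: (ellipsoid_sub cKM sKM BM Kp' p'r r1 d0 d1 a0 b0 aE bE Bx).
apply/negP; rewrite -ltNge det_mulmx normrM dD gtr0_norm// mulrC.
by rewrite -ltr_pdivrMr.
Qed.

(** A ball around an interior point p is contained in K, and so is its mirror
    image around -p; averaging the two centres the ball at the origin. *)
Lemma convex_body_ball n (K : set 'rV[R]_n) : convex_body K -> symmetric_body K ->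
  exists2 e, 0 < e & eball e `<=` K.
Proof.
move=> [/convex_setE cK _ [p intp]] sK.
have /nbhs_ballP[e /= e0 peK] : nbhs p K by exact: intp.
exists (e / 2); first by rewrite divr_gt0.
move=> x xe.
have xp : K (p + x).
  apply: peK; split => // i j; rewrite ord1 mxE -ball_normE /= opprD addrA subrr
    add0r normrN.
  apply: le_lt_trans (coord_enorm x j) _; apply: le_lt_trans xe _; lra.
have xp' : K (x - p).
  rewrite -[X in K X]opprK; apply: sK; rewrite opprB.
  apply: peK; split => // i j; rewrite ord1 !mxE -ball_normE /= opprB addrC subrK.
  apply: le_lt_trans (coord_enorm x j) _; apply: le_lt_trans xe _; lra.
have h0 : (0 : R) <= 2^-1 by rewrite invr_ge0.
have h1 : 2^-1 <= 1 :> R by rewrite invf_le1 ?ler1n.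
have := cK _ _ _ h0 h1 xp xp'.
rewrite (_ : 1 - 2^-1 = 2^-1 :> R); last by lra.
rewrite -scalerDr addrC addrA subrK scalerDr -scalerDl.
by rewrite (_ : 2^-1 + 2^-1 = 1 :> R) ?scale1r//; lra.
Qed.

Lemma compact_eball n (K : set 'rV[R]_n) : compact K -> exists r, K `<=` eball r.
Proof.
move=> /compact_bounded[M [Mreal KM]].
exists (Num.sqrt n%:R * (`|M| + 1)) => x Kx.
have M0 : 0 <= `|M| + 1 by rewrite addr_ge0.
apply: (enorm_cube M0) => i.
have xM : `|x| <= `|M| + 1.
  by apply: KM => //; apply: le_lt_trans (ler_norm _) _; rewrite ltrDl.
apply: le_trans xM; rewrite [leRHS]/Num.norm /= mx_normrE.
by apply: (le_bigmax _ _ (0, i)).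
Qed.

(** With s = sqrt (k + 1), the radius r = (s + 1) / q - 1 > s and the layer
    ratio l = 1 / q > 1 give 2 / (r + 1) / l = 2 / (s + 1) q^2. *)
Lemma vol_product_ge_approx k (K : set 'rV[R]_k.+1) q : (0 < k)%N ->
  convex_body K -> symmetric_body K -> 0 < q -> q < 1 ->
  (((2 / (Num.sqrt k.+1%:R + 1) * q ^+ 2) ^+ k.+1)%:E * vol (@punctured_ball R
    k.+1) ^+ 2 <=
     vol K * vol (polar K))%E.
Proof.
move=> k0 bK sK q0 q1.
have [e e0 eK] := convex_body_ball bK sK.
have [cK KK _] := bK.
have [r0 Kr0] := compact_eball KK.
have mK : borel K by apply: closed_borel; apply: compact_closed => //;
  exact: norm_hausdorff.
have Kfin : (vol K < +oo)%E.
  by apply: le_lt_trans (vol_le mK (borel_eball _) Kr0) (vol_eball_fin _ _).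
move/convex_setE in cK.
set s : R := Num.sqrt k.+1%:R.
have s1 : 1 <= s by rewrite -(sqrtr1 R) ler_wsqrtr// ler1n.
pose r := (s + 1) / q - 1.
have rq : (r + 1) * q = s + 1 by rewrite /r subrK divfK// gt_eqF.
have rs : s < r by rewrite /r ltrBrDr ltr_pdivlMr//; nra.
have kr : k.+1%:R < r ^+ 2.
  by rewrite -[ltLHS](@sqr_sqrtr R)// ltr_sqr ?nnegrE ?sqrtr_ge0//; lra.
have r1 : 1 < r by lra.
have [M uM [BM Mr]] := john_position k0 kr r1 cK sK mK Kfin e0 eK.
rewrite -(vol_product_pullback mK uM).
have l1 : 1 < q^-1 by rewrite invf_gt1.
have := vol_product_layers (@is_convex_pullback _ _ M cK) (@symmetric_pullback _ _
  M sK) (borel_mulmx M mK) BM Mr r1 l1.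
congr (((_ ^+ _)%:E * _) <= _)%E.
rewrite invrK; have -> : r + 1 = (s + 1) / q by rewrite -rq mulfK// gt_eqF.
by field; rewrite !gt_eqF//; lra.
Qed.

(** Let q tend to 1 in [vol_product_ge_approx]; Bernoulli's inequality makes
    the limit explicit. *)
Theorem vol_product_ge k (K : set 'rV[R]_k.+1) : (0 < k)%N ->
  convex_body K -> symmetric_body K ->
  (((2 / (Num.sqrt k.+1%:R + 1)) ^+ k.+1)%:E * vol (@punctured_ball R k.+1) ^+ 2 <=
     vol K * vol (polar K))%E.
Proof.
move=> k0 bK sK.
set c : R := 2 / _.
have c0 : 0 < c by rewrite divr_gt0// ltr_wpDl ?sqrtr_ge0.
have PE : (0 <= vol K * vol (polar K))%E by rewrite mule_ge0 ?vol_ge0.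
have := fun q => @vol_product_ge_approx k K q k0 bK sK.
case: (vol K * vol (polar K))%E PE => [P| |]; [|by move=> *;
  rewrite leey|by rewrite leeNy_eq].
rewrite lee_fin => P0.
have VE : vol (@punctured_ball R k.+1) = (fine (vol (@punctured_ball R k.+1)))%:E
    by apply: esym; apply: fineK; exact: vol_punctured_ball_fin.
rewrite VE; set V := fine _ => h.
rewrite -EFin_expe -EFinM lee_fin; set X := _ * _.
have X0 : 0 <= X by rewrite mulr_ge0 ?sqr_ge0// exprn_ge0// ltW.
apply/ler_addgt0Pr => d d0.
pose m : R := (2 * k.+1)%:R.
have m0 : 0 < m by rewrite ltr0n.
have Xm0 : 0 < X * m + d by rewrite ltr_wpDl// mulr_ge0// ltW.
(* Chosen so that X m e <= d; adding d keeps the denominator positive. *)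
pose e := d / (X * m + d) / 2.
have eE : e * (X * m + d) = d / 2 by rewrite /e mulrAC divfK// gt_eqF.
have e0 : 0 < e by rewrite !divr_gt0.
have Xm : 0 <= X * m by rewrite mulr_ge0// ltW.
have e1 : e < 1 by nra.
have := h (1 - e); rewrite subr_gt0 => /(_ e1); rewrite ltrBlDr ltrDl => /(_ e0).
rewrite -EFin_expe -EFinM lee_fin exprMn -exprM mulrAC -/X => h1.
have := ler_wpM2l X0 (bernoulli_ge (2 * k.+1)%N (ltW e0) (ltW e1)) => h2.
have := le_trans h2 h1; rewrite -/m => h3.
nra.
Qed.

End john.

(** * Upper bound on alpha *)

Section alpha_upper.
Context {R : realType}.
Local Notation leb := (@lebesgue_measure R).

(** The integral of a nonnegative function is a supremum over the simple
    functions below it, whence monotonicity for arbitrary domains and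
    integrands, such as the sectors of S and S°. *)
Lemma ge0_integral_le d (X : measurableType d) (mu : {measure set X -> \bar R})
    (D1 D2 : set X) (f1 f2 : X -> \bar R) :
  (forall x, D1 x -> 0 <= f1 x)%E -> (forall x, D2 x -> 0 <= f2 x)%E ->
  (forall x, D1 x -> D2 x /\ (f1 x <= f2 x)%E) ->
  (\int[mu]_(x in D1) f1 x <= \int[mu]_(x in D2) f2 x)%E.
Proof.
move=> f10 f20 f12; rewrite !ge0_integralE//.
apply: ge_ereal_sup => _ [h hf <-]; apply: ereal_sup_ubound; exists h => // x.
apply: le_trans (hf x) _; rewrite !patchE.
case: ifPn => [/set_mem D1x|_]; last by case: ifPn => // /set_mem/f20.
by have [D2x f12x] := f12 _ D1x; rewrite mem_set.
Qed.

Lemma dotp_circle_pt s t : dotp (circle_pt s) (circle_pt t) = cos (s - t) :> R.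
Proof. by rewrite /dotp !big_ord_recl big_ord0 !mxE /= addr0 cosB addrC. Qed.

Lemma enorm_circle_pt t : enorm (circle_pt t) = 1 :> R.
Proof. by rewrite /enorm dotp_circle_pt subrr cos0 sqrtr1. Qed.

Lemma circle_pt_inj (s t : R) : 0 <= s -> s < 2 * pi -> 0 <= t -> t < 2 * pi ->
  circle_pt s = circle_pt t -> s = t.
Proof.
move=> s0 sp t0 tp st.
have c1 : cos (s - t) = 1 by rewrite -dotp_circle_pt st dotp_circle_pt subrr cos0.
wlog : s t s0 sp t0 tp {st} c1 / t <= s => [hw|ts].
  have [|/ltW st'] := leP t s; first exact: hw.
  by apply/esym; apply: hw => //; rewrite -opprB cosN.
apply/eqP; rewrite -subr_eq0; apply: contraT => st0.
have h0 : 0 < (s - t) / 2 by rewrite divr_gt0// lt_neqAle eq_sym st0 subr_ge0.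
have hp : (s - t) / 2 < pi by lra.
have : 0 < sin ((s - t) / 2) by apply: sin_gt0_pi; rewrite h0 hp.
have : cos (s - t) = 1 - sin ((s - t) / 2) ^+ 2 *+ 2.
  rewrite {1}(_ : s - t = ((s - t) / 2) *+ 2); last by lra.
  rewrite cos_mulr2n cos2sin2; lra.
rewrite c1 => h1 h2; have : 0 < sin ((s - t) / 2) ^+ 2 by rewrite exprn_gt0.
lra.
Qed.

Definition arc (a b : R) : set 'rV[R]_2 := circle_pt @` `[a, b].

Lemma arcE a b t : 0 <= a -> b < 2 * pi -> 0 <= t -> t < 2 * pi ->
  arc a b (circle_pt t) -> a <= t <= b.
Proof.
move=> a0 b1 t0 t1 [s]; rewrite /= in_itv/= => /andP[as_ sb] st.
have -> : t = s by apply/esym/circle_pt_inj => //;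
  [exact: le_trans as_|exact: le_lt_trans b1].
by rewrite as_.
Qed.

Lemma cone_arcE a b r t : 0 < r -> cone (arc a b) (r *: circle_pt t) ->
  arc a b (circle_pt t).
Proof.
move=> r0 [s s0 [u abu su]].
have u1 : enorm u = 1 by case: abu => x _ <-; exact: enorm_circle_pt.
have sr : s = r.
  have := congr1 enorm su; rewrite !enormZ u1 enorm_circle_pt !mulr1 (gtr0_norm r0).
  by move: s0; rewrite /= in_itv/= andbT => s0; rewrite ger0_norm.
suff <- : u = circle_pt t by [].
by apply: (scalerI (lt0r_neq0 r0)); rewrite -su sr.
Qed.

Lemma integral_FTC (f F : R -> R) (a b : R) : a <= b ->
  continuous f -> continuous F -> (forall x, a < x -> is_derive x 1 F (f x)) ->
  (\int[leb]_(x in `[a, b]) (f x)%:E = (F b - F a)%:E)%E.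
Proof.
rewrite le_eqVlt => /predU1P[<-|ab] cf cF dF.
  by rewrite set_itv1 integral_set1 subrr.
rewrite (@continuous_FTC2 _ f F)//.
- by apply: continuous_subspaceT => x; exact: cf.
- split.
  + by move=> x; rewrite in_itv/= => /andP[ax _]; have := dF _ ax; case.
  + by apply: cvg_at_right_filter; exact: cF.
  + by apply: cvg_at_left_filter; exact: cF.
- move=> x; rewrite in_itv/= => /andP[ax _]; rewrite derive1E.
  by have := dF _ ax; case.
Qed.

Lemma integral_exprn m (r : R) : 0 <= r ->
  (\int[leb]_(x in `[0%R, r]) (x ^+ m)%:E = (r ^+ m.+1 / m.+1%:R)%:E)%E.
Proof.
move=> r0.
pose F : R -> R := m.+1%:R^-1 *: (@id R) ^+ m.+1.
have FE x : F x = m.+1%:R^-1 * x ^+ m.+1.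
  by rewrite /F -[LHS]/(m.+1%:R^-1 * ((@id R) ^+ m.+1) x) exprfctE.
have dF (x : R) : is_derive x 1 F (x ^+ m).
  have h := is_deriveZ m.+1%:R^-1 (is_deriveX m.+1 (is_derive_id x (1 : R))).
  apply: is_derive_eq.
  by rewrite /= -[LHS]/(m.+1%:R^-1 * (m.+1%:R * x ^+ m * 1)) mulr1 mulrA mulVf ?mul1r.
rewrite (@integral_FTC (fun x => x ^+ m) F)//.
- by rewrite !FE expr0n mulr0 subr0 mulrC.
- exact: exprn_continuous.
- move=> x; rewrite (_ : F = fun x => m.+1%:R^-1 * x ^+ m.+1); last exact/funext.
  by apply: cvgM; [exact: cvg_cst|exact: exprn_continuous].
Qed.

Lemma arc_integralE m theta a b : 0 <= a -> b < 2 * pi ->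
  arc_integral m theta (arc a b) = (\int[leb]_(t in `[a, b]) (gweight m theta t)%:E)%E.
Proof.
move=> a0 b1; rewrite /arc_integral; congr (integral _ _ _).
apply/seteqP; split => t /=.
  by move=> [/andP[t0 t1]] h; rewrite in_itv/=; exact: arcE h.
rewrite in_itv/= => /andP[at_ tb]; split.
  by rewrite (le_trans a0 at_)/= (le_lt_trans tb b1).
by exists t => //=; rewrite in_itv/= at_.
Qed.

Lemma gweight_ge0 m theta t : 0 <= gweight m theta t :> R.
Proof. by rewrite exprn_ge0. Qed.

Lemma continuous_gweight m theta : continuous (@gweight R m theta).
Proof.
move=> t; apply: (@continuous_comp _ _ _ (fun t => `|cos (t + theta)|) (fun x => x
  ^+ (m - 1))); last exact: exprn_continuous.
apply: (@continuous_comp _ _ _ (fun t => cos (t + theta)) (fun x : R => `|x|));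
  last exact: norm_continuous.
apply: (@continuous_comp _ _ _ (fun t => t + theta) cos); last exact: continuous_cos.
by apply: cvgD; [exact: cvg_id|exact: cvg_cst].
Qed.

Lemma integral_indic_mul (f : R -> R) (a b : R) :
  (\int[leb]_x (f x * \1_(`[a, b]%classic) x)%:E = \int[leb]_(x in `[a, b]) (f x)%:E)%E.
Proof.
rewrite [RHS]integral_mkcond; apply: eq_integral => x _.
rewrite patchE indicE; case: (boolP (x \in _)) => _; first by rewrite mulr1.
by rewrite mulr0.
Qed.

(** The set is contained in the sector of radius rho over the arc, where the
    integral is a product. *)
Lemma mu2_arc_le m theta a b A rho : 0 <= a -> b < 2 * pi -> 0 <= rho ->
  (forall r t, 0 < r -> a <= t <= b -> A (r *: circle_pt t) -> r <= rho) ->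
  (mu2 m theta (cone (arc a b) `&` A) <=
   (rho ^+ m.+1 / m.+1%:R)%:E * \int[leb]_(t in `[a, b]) (gweight m theta t)%:E)%E.
Proof.
move=> a0 b1 rho0 hA.
pose h1 x : R := x ^+ m * \1_(`[0, rho]%classic) x.
pose h2 x : R := gweight m theta x * \1_(`[a, b]%classic) x.
have h10 x : 0 <= h1 x.
  rewrite /h1 indicE; case: (boolP (x \in _)) => [/set_mem|_]; last by rewrite mulr0.
  by rewrite /= in_itv/= => /andP[x0 _]; rewrite mulr1 exprn_ge0.
have h20 x : 0 <= h2 x by rewrite mulr_ge0// gweight_ge0.
have mh1 : measurable_fun [set: R] h1.
  apply: measurable_funM; first exact: exprn_measurable.
  exact: measurable_indic.
have mh2 : measurable_fun [set: R] h2.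
  apply: measurable_funM; last exact: measurable_indic.
  by apply: continuous_measurable_fun; exact: continuous_gweight.
apply: (@le_trans _ _ (\int[(leb \x leb)%E]_p (h1 p.1 * h2 p.2)%:E)%E).
  apply: ge0_integral_le.
  - by move=> p [/= p0 _ _]; rewrite lee_fin mulr_ge0 ?gweight_ge0// exprn_ge0// ltW.
  - by move=> p _; rewrite lee_fin mulr_ge0.
  - move=> [r t] [/= r0 /andP[t0 t1] [Cr Ar]]; split => //.
    have abt : a <= t <= b by apply: arcE => //; exact: cone_arcE Cr.
    have rr : r <= rho by exact: hA Ar.
    by rewrite lee_fin /h1 /h2 !indicE !mem_set ?mulr1//= in_itv/= ?(ltW r0).
rewrite (@fubini_tonelli1 _ _ _ _ _ leb leb (fun p : R * R => (h1 p.1 * h2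
  p.2)%:E))//; last 2 first.
- apply/measurable_EFinP; apply: measurable_funM.
    exact: (measurableT_comp mh1).
  exact: (measurableT_comp mh2).
- by move=> p; rewrite lee_fin mulr_ge0.
rewrite /fubini_F /=.
under eq_integral => x _ do under eq_integral => y _ do rewrite EFinM.
under eq_integral => x _.
  rewrite ge0_integralZl//; last 3 first.
    exact/measurable_EFinP.
    by move=> y _; rewrite lee_fin.
    by rewrite lee_fin.
  over.
rewrite ge0_integralZr//; last 3 first.
- exact/measurable_EFinP.
- by move=> x _; rewrite lee_fin.
- by apply: integral_ge0 => y _; rewrite lee_fin.
by rewrite /h1 /h2 !integral_indic_mul integral_exprn.
Qed.

(** The weight cancels against the denominator; gam only ensures that its
    integral is not zero. *)
Lemma alpha_quot_arc_le m theta a b S rho1 rho2 gam :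
  0 <= a -> a < b -> b < 2 * pi -> 0 <= rho1 -> 0 <= rho2 -> 0 < gam ->
  (forall t, a <= t <= b -> gam <= gweight m theta t) ->
  (forall r t, 0 < r -> a <= t <= b -> S (r *: circle_pt t) -> r <= rho1) ->
  (forall r t, 0 < r -> a <= t <= b -> polar S (r *: circle_pt t) -> r <= rho2) ->
  (alpha_quot m theta (arc a b) S <= ((rho1 * rho2) ^+ m.+1 / m.+1%:R ^+ 2)%:E)%E.
Proof.
move=> a0 ab b1 r10 r20 gam0 hg hS hP; rewrite /alpha_quot.
have lenE : leb `[a, b]%classic = (b - a)%:E.
  by rewrite lebesgue_measure_itv/= lte_fin ab EFinN.
case: asboolP => [[u Iu]|_].
  have : circle_pt a = circle_pt b.
    have := erefl (arc a b); rewrite {2}Iu => h.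
    have ha : arc a b (circle_pt a) by exists a => //=; rewrite in_itv/= lexx ltW.
    have hb : arc a b (circle_pt b) by exists b => //=; rewrite in_itv/= lexx ltW.
    by move: ha hb; rewrite h => /= -> ->.
  move=> /circle_pt_inj abE; have : a = b by apply: abE => //; lra.
  by move=> abE'; move: ab; rewrite abE' ltxx.
rewrite arc_integralE//.
set G := (\int[leb]_(t in _) _)%E.
have G1 : ((gam * (b - a))%:E <= G)%E.
  apply: (@le_trans _ _ (\int[leb]_(t in `[a, b]) gam%:E)%E).
    by rewrite integral_cst// [X in (_ <= _ * X)%E](_ : _ = (b - a)%:E) ?EFinM//;
      exact: lenE.
  apply: ge0_integral_le => t.
  - by move=> _; rewrite lee_fin ltW.
  - by move=> _; rewrite lee_fin gweight_ge0.
  - by move=> h; split => //; rewrite lee_fin; apply: hg; move: h; rewrite /= in_itv.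
have G2 : (G <= (b - a)%:E)%E.
  apply: (@le_trans _ _ (\int[leb]_(t in `[a, b]) 1)%E); last first.
    by rewrite integral_cst// mul1e [X in (X <= _)%E](_ : _ = (b - a)%:E)//;
      exact: lenE.
  apply: ge0_integral_le => t h; rewrite ?lee_fin ?gweight_ge0//.
  by split => //; rewrite exprn_ile1// cos_max.
have G0 : (0 <= G)%E by apply: le_trans G1; rewrite lee_fin mulr_ge0// ?subr_ge0 ltW.
have GE : G = (fine G)%:E.
  by rewrite fineK// ge0_fin_numE//; apply: le_lt_trans G2 _; rewrite ltry.
pose g := fine G.
have g0 : 0 < g.
  by move: G1; rewrite GE lee_fin; apply: lt_le_trans; rewrite mulr_gt0// subr_gt0.
have h1 := mu2_arc_le m theta a0 b1 r10 hS.
have h2 := mu2_arc_le m theta a0 b1 r20 hP.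
rewrite -/G in h1 h2.
have m1 A : (0 <= mu2 m theta A)%E.
  apply: integral_ge0 => p [/= p0 _ _]; rewrite lee_fin mulr_ge0 ?gweight_ge0//.
  by rewrite exprn_ge0// ltW.
rewrite GE -/g in h1 h2 *.
rewrite -EFin_expe inver gt_eqF ?exprn_gt0//.
apply: le_trans (lee_wpmul2r _ (lee_pmul (m1 _) (m1 _) h1 h2)) _.
  by rewrite lee_fin invr_ge0 exprn_ge0// ltW.
rewrite -!EFinM lee_fin exprMn le_eqVlt; apply/orP; left; apply/eqP.
have : (m.+1%:R : R) != 0 by rewrite pnatr_eq0.
move: (m.+1%:R : R) => N N0; field.
by rewrite N0 gt_eqF.
Qed.

Lemma cos_le (x y : R) : 0 <= x -> x <= y -> y <= pi -> cos y <= cos x.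
Proof.
move=> x0 xy yp; rewrite leNgt; apply/negP => h.
have : y < x by rewrite -ltr_cos// in_itv/= ?x0 ?yp ?(le_trans x0 xy) ?(le_trans xy yp).
by rewrite ltNge xy.
Qed.

(** The zeros of the weight are isolated: if 0 is one of them, a small positive
    angle is not. *)
Lemma exists_subarc m theta (d : R) : 0 < d -> exists a b gam : R,
  [/\ 0 <= a, a < b, b <= d & 0 < gam] /\
  (forall t, a <= t <= b -> gam <= gweight m theta t).
Proof.
move=> d0.
have [a [a0 ad ga]] : exists a, [/\ 0 <= a, a < d & 0 < gweight m theta a].
  have [c0|c0] := eqVneq (cos theta) 0; last first.
    exists 0; rewrite lexx d0; split => //.
    by rewrite /gweight add0r exprn_gt0// normr_gt0.
  pose e := Num.min (d / 2) 1.
  have e0 : 0 < e by rewrite lt_min divr_gt0/=.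
  have e1 : e <= 1 by rewrite ge_min lexx orbT.
  have ed : e <= d / 2 by rewrite ge_min lexx.
  exists e; split; [exact: ltW|lra|].
  rewrite exprn_gt0// normr_gt0 cosD c0 mulr0 sub0r oppr_eq0 mulf_neq0//.
    rewrite gt_eqF// sin_gt0_pi// e0/=.
    by have := @pi_ge2 R; lra.
  apply/eqP => s0; have := cos2Dsin2 theta; rewrite c0 s0 expr0n addr0 => /eqP.
  by rewrite eq_sym oner_eq0.
have ga2 : 0 < gweight m theta a / 2 by rewrite divr_gt0.
have /cvgrPdist_lt/(_ _ ga2)[e /= e0 he] := @continuous_gweight m theta a.
exists a, (Num.min d (a + e / 2)), (gweight m theta a / 2); split; first split => //.
- by rewrite lt_min ad ltrDl divr_gt0.
- by rewrite ge_min lexx.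
move=> t /andP[at_]; rewrite le_min => /andP[_ te].
have : `|a - t| < e by rewrite ler0_norm ?subr_le0//; lra.
move=> /he; rewrite ltr_norml => /andP[_ ?]; lra.
Qed.

(** For cos phi = 1 / sqrt (m + 1), the point of norm sqrt (m + 1) at angle
    -phi/2 lies on the edge of the slab, and the direction 0 bisects this point
    and the normal of the slab. *)
Definition slab_body m (phi : R) : set 'rV[R]_2 :=
  [set x | `|dotp x (circle_pt (phi / 2))| <= 1] `&` eball (Num.sqrt m.+1%:R).

Lemma slab_body_class m phi : body_class m (slab_body m phi).
Proof.
have s1 : 1 <= Num.sqrt m.+1%:R :> R by rewrite -{1}(sqrtr1 R) ler_wsqrtr// ler1n.
have s0 : 0 <= Num.sqrt m.+1%:R :> R by rewrite sqrtr_ge0.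
have B1 : eball 1 `<=` slab_body m phi.
  move=> x x1; split => /=; last exact: le_trans x1 s1.
  apply: le_trans (normr_dotp _ _) _; rewrite enorm_circle_pt mulr1; exact: x1.
split=> //; last by move=> x [].
- split.
  + apply/convex_setE => x y t t0 t1 [/= x1 x2] [/= y1 y2]; split => /=.
      rewrite dotpDl !dotpZl; apply: le_trans (ler_normD _ _) _.
      rewrite !normrM (ger0_norm t0) (ger0_norm (_ : 0 <= 1 - t)) ?subr_ge0//.
      by rewrite /eball /= in x2 y2; nra.
    rewrite /eball /=; apply: le_trans (enormD _ _) _; rewrite !enormZ.
    rewrite (ger0_norm t0) (ger0_norm (_ : 0 <= 1 - t)) ?subr_ge0//.
    rewrite /eball /= in x2 y2; nra.
  + apply: bounded_closed_compact.
      exists (Num.sqrt m.+1%:R); split; first exact: num_real.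
      move=> M sM x [_ xs]; rewrite /= [leLHS]/Num.norm /= mx_normrE.
      apply/bigmax_leP; split => [|i _]; first by apply: le_trans (ltW sM).
      rewrite (_ : i.1 = 0) ?ord1//; apply: le_trans (coord_enorm _ _) _.
      exact: le_trans xs (ltW sM).
    by apply: closedI; [exact: closed_slab|exact: closed_eball].
  + exists 0; apply/nbhs_ballP; exists (2^-1) => /=; first by rewrite invr_gt0.
    move=> x [_ h]; apply: B1.
    have h2 : 0 <= 2^-1 :> R by rewrite invr_ge0.
    have : @cube R 2 (2^-1) x.
      by move=> i; have := h 0 i; rewrite -ball_normE/= !mxE sub0r normrN => /ltW.
    move=> /(enorm_cube h2) /le_trans; apply.
    rewrite ler_pdivrMr// mul1r -[leRHS]ger0_norm// -sqrtr_sqr ler_wsqrtr//.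
    by rewrite expr2 -natrM ler_nat.
- move=> x [/= x1 x2]; split => /=; first by rewrite dotpNl normrN.
  by rewrite /eball /= -scaleN1r enormZ normrN1 mul1r.
Qed.

(** On the arc from 0 to d, the slab bounds the radius of S by 1 / cos h, and the
    point at angle -h bounds that of the polar by 1 / (s cos (d + h)), where
    h = phi / 2. As d tends to 0 the product of the two bounds tends to
    1 / (s cos^2 h) = 2 / (s + 1). *)
Lemma alpha_le m : (0 < m)%N ->
  (alpha m <= ((2 / (Num.sqrt m.+1%:R + 1)) ^+ m.+1 / m.+1%:R ^+ 2 : R)%:E)%E.
Proof.
move=> m0; set n : R := m.+1%:R; set s : R := Num.sqrt n.
have s1 : 1 < s by rewrite -{1}(sqrtr1 R) ltr_sqrt ?ltr1n// ltr0n.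
have s0 : 0 < s by lra.
pose phi := acos s^-1.
have si : -1 <= s^-1 <= 1.
  by apply/andP; split; [rewrite (@le_trans _ _ 0)//
    invr_ge0 ltW|rewrite invf_le1// ltW].
have cphi : cos phi = s^-1 by apply: acosK; rewrite in_itv/=.
have phi0 : 0 < phi by apply: acos_gt0; rewrite (andP si).1 invf_lt1.
have phip : phi <= pi by exact: acos_lepi.
pose h := phi / 2.
have h0 : 0 < h by rewrite divr_gt0.
have phE : phi = h + h by rewrite /h; lra.
have ch2 : cos h ^+ 2 = (s + 1) / (2 * s).
  have := cos_mulr2n h; rewrite (_ : h *+ 2 = phi); last by rewrite phE mulr2n.
  rewrite cphi => E; have -> : cos h ^+ 2 = (s^-1 + 1) / 2 by lra.
  by field; rewrite gt_eqF.
have ch : 0 < cos h.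
  have c0 : 0 <= cos h by apply: cos_ge0_pihalf; apply/andP; split;
    have := @pi_gt0 R; lra.
  rewrite lt_neqAle c0 andbT eq_sym -sqrf_eq0 ch2 gt_eqF// divr_gt0//; lra.
pose f (d : R) := ((cos h)^-1 * (s * cos (d + h))^-1) ^+ m.+1 / n ^+ 2.
have f0 : f 0 = (2 / (s + 1)) ^+ m.+1 / n ^+ 2.
  rewrite /f add0r; congr (_ ^+ _ / _).
  rewrite -invfM mulrCA -expr2 ch2; field; rewrite !gt_eqF//; lra.
have cf : {for 0, continuous f}.
  rewrite /f; apply: cvgM; last exact: cvg_cst.
  apply: (@cvg_comp _ _ _ (fun d => (cos h)^-1 * (s * cos (d + h))^-1) (fun x => x
    ^+ m.+1)); last exact: exprn_continuous.
  apply: cvgM; first exact: cvg_cst.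
  apply: cvgV; first by rewrite add0r mulf_neq0 ?gt_eqF.
  apply: cvgM; first exact: cvg_cst.
  apply: (@cvg_comp _ _ _ (fun d => d + h) cos); last exact: continuous_cos.
  by apply: cvgD; [exact: cvg_id|exact: cvg_cst].
pose S := slab_body m phi.
apply: (@le_trans _ _ (alpha_body m S)).
  by apply: ereal_inf_lbound; exists S => //; exact: slab_body_class.
apply: ge_ereal_sup => _ [theta _ <-].
apply/lee_addgt0Pr => e e0; rewrite -f0.
have /cvgrPdist_lt/(_ _ e0)[d /= d0 hd] := cf.
pose d' := Num.min (d / 2) h.
have d'0 : 0 < d' by rewrite lt_min divr_gt0.
have d'd : d' <= d / 2 by rewrite ge_min lexx.
have d'h : d' <= h by rewrite ge_min lexx orbT.
have fd' : f d' <= f 0 + e.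
  have : `|0 - d'| < d by rewrite sub0r normrN gtr0_norm//; lra.
  by move=> /hd; rewrite ltr_norml => /andP[? _]; lra.
have [a [b [gam [[a0 ab bd gam0] hg]]]] := exists_subarc m theta d'0.
have cd' : 0 < cos (d' + h).
  apply: (@lt_le_trans _ _ (cos phi)); first by rewrite cphi invr_gt0.
  by apply: cos_le; lra.
have pi0 := @pi_gt0 R.
apply: (@le_trans _ _ (alpha_quot m theta (arc a b) S)).
  apply: ereal_inf_lbound; exists (arc a b) => //.
  by exists a, b; split => //; [exact: ltW|lra].
apply: (@le_trans _ _ (f d')%:E); last by rewrite -EFinD lee_fin.
apply: (@alpha_quot_arc_le _ _ _ _ _ _ _ gam) => //.
- lra.
- by rewrite invr_ge0 ltW.
- by rewrite invr_ge0 mulr_ge0// ltW.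
- move=> r t r0 /andP[at_ tb] [/= h1 _].
  rewrite -[leRHS]mul1r ler_pdivlMr//; apply: le_trans h1.
  rewrite dotpZl dotp_circle_pt normrM (gtr0_norm r0) ler_pM2l//.
  apply: le_trans (ler_norm _); rewrite -[cos (t - _)]cosN opprB -/h.
  by apply: cos_le; lra.
- move=> r t r0 /andP[at_ tb] hP.
  have : S (s *: circle_pt (- h)).
    split => /=; last by rewrite /eball /= enormZ enorm_circle_pt mulr1 gtr0_norm.
    rewrite dotpZl dotp_circle_pt -/h -opprD cosN -phE cphi divff ?normr1// gt_eqF//.
  move=> /hP; rewrite dotpZl dotpZr dotp_circle_pt opprK => h1.
  rewrite -[leRHS]mul1r ler_pdivlMr ?mulr_gt0//; apply: le_trans h1.
  rewrite !normrM (gtr0_norm r0) (gtr0_norm s0) ler_pM2l// ler_pM2l//.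
  by apply: le_trans (ler_norm _); apply: cos_le; lra.
Qed.

End alpha_upper.

(** * Surface area of the sphere *)

Section ball_volume.
Context {R : realType}.
Local Notation leb := (@lebesgue_measure R).
Local Notation T := (measurableTypeR R).

Lemma continuous_expRN : continuous (fun t : R => expR (- t)).
Proof.
move=> x; apply: (@continuous_comp _ _ _ -%R expR); last exact: continuous_expR.
exact: opp_continuous.
Qed.

Lemma integral_expRN (q : R) :
  (\int[leb]_(t in `[q, +oo[) (expR (- t))%:E = (expR (- q))%:E)%E.
Proof.
rewrite (@ge0_continuous_FTC2y _ (fun t => expR (- t)) (fun t => - expR (- t)) _ 0)//.
- by rewrite EFinN oppeK add0e.
- by apply: continuous_subspaceT => x; exact: continuous_expRN.
- by rewrite -oppr0; apply: cvgN; exact: cvgr_expR.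
- by apply: cvgN; apply: cvg_at_right_filter; exact: continuous_expRN.
- move=> x _; rewrite derive1_comp// derive1N// derive1_id mulN1r derive1_comp//
  derive1N//.
  rewrite derive1E (congr1 (fun f => f (- x)) (@derive_expR R)).
  by rewrite derive1_id mulrN1 opprK.
Qed.

Lemma integral_mul_indic d (X : measurableType d) (mu : {measure set X -> \bar R})
    (f : X -> R) (A : set X) :
  (\int[mu]_x (f x * \1_A x)%:E = \int[mu]_(x in A) (f x)%:E)%E.
Proof.
rewrite [RHS]integral_mkcond; apply: eq_integral => x _.
by rewrite patchE indicE; case: (boolP (x \in _)) => _; rewrite ?mulr1 ?mulr0.
Qed.

Lemma measurable_le_set d (X : measurableType d) (f g : X -> R) :
  measurable_fun setT f -> measurable_fun setT g -> measurable [set x | f x <= g x].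
Proof.
move=> mf mg; have := measurable_fun_ler mf mg measurableT (I : measurable [set true]).
by rewrite setTI; congr measurable; apply/seteqP; split.
Qed.

(** Fubini's theorem applied to exp(-q) = integral of exp(-t) over t >= q. *)
Lemma integral_expR_layer d (X : measurableType d)
    (mu : {sigma_finite_measure set X -> \bar R}) (q w : X -> R) :
  measurable_fun setT q -> measurable_fun setT w -> (forall x, 0 <= w x) ->
  (\int[mu]_x (w x * expR (- q x))%:E =
   \int[leb]_t ((expR (- t))%:E * \int[mu]_(x in [set x | (q x <= t)%R]) (w x)%:E))%E.
Proof.
move=> mq mw w0.
pose L := [set p : X * T | q p.1 <= p.2].
have mL : measurable L.
  apply: measurable_le_set; last exact: measurable_snd.
  exact: measurableT_comp mq measurable_fst.
pose F (p : X * T) : \bar R := (w p.1 * (expR (- p.2) * \1_L p))%:E.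
have mexp : measurable_fun [set: T] (fun t => expR (- t)).
  by apply: continuous_measurable_fun; exact: continuous_expRN.
have mF : measurable_fun setT F.
  apply/measurable_EFinP; apply: measurable_funM;
    first exact: measurableT_comp mw measurable_fst.
  apply: measurable_funM; first exact: measurableT_comp mexp measurable_snd.
  exact: measurable_indic.
have F0 p : (0 <= F p)%E by rewrite lee_fin !mulr_ge0 ?expR_ge0.
have := @fubini_tonelli _ _ _ _ R mu leb F mF F0.
rewrite /F /= => E.
transitivity (\int[mu]_x \int[leb]_t F (x, t))%E.
  apply: eq_integral => x _.
  transitivity ((w x)%:E * \int[leb]_t (expR (- t) * \1_(`[q x, +oo[) t)%:E)%E.
    by rewrite integral_mul_indic integral_expRN EFinM.
  rewrite -ge0_integralZl//; last 2 first.
  - apply/measurable_EFinP; apply: measurable_funM => //; exact: measurable_indic.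
  - by rewrite lee_fin.
  apply: eq_integral => t _; rewrite -EFinM /F /=; congr (_ * (_ * _))%:E.
  rewrite !indicE; congr (_ _)%:R; apply/idP/idP; rewrite !inE /L /= in_itv/= andbT//.
rewrite E; apply: eq_integral => t _.
have mA : measurable [set x | q x <= t].
  by apply: measurable_le_set => //; exact: measurable_cst.
rewrite -ge0_integralZl//; last 2 first.
- by apply/measurable_EFinP; exact: measurable_funS mw.
- by move=> x _; rewrite lee_fin.
rewrite [RHS](eq_integral (fun x => (expR (- t) * w x)%:E)); last by move=> x _;
  rewrite EFinM.
rewrite -[RHS]integral_mul_indic; apply: eq_integral => x _.
rewrite mulrA [w x * _]mulrC; congr (_ * _)%:E.
Qed.

Lemma measurable_sqdist n :
  measurable_fun [set: n.-tuple T] (fun t => dotp (vec t) (vec t) : T).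
Proof.
rewrite /dotp; apply: measurable_sum => j.
by apply: measurable_funM; exact: borel_coord.
Qed.

Lemma measurable_gauss n :
  measurable_fun [set: n.-tuple T] (fun t => @expR R (- dotp (vec t) (vec t))).
Proof.
apply: (@measurableT_comp _ _ _ _ _ _ (fun x : T => @expR R (- x))).
  by apply: continuous_measurable_fun; exact: continuous_expRN.
exact: measurable_sqdist.
Qed.

Lemma integral_gauss_tuple n :
  (\int[lebesgue_tuple n]_t (@expR R (- dotp (vec t) (vec t)))%:E = (Num.sqrt pi ^+
    n)%:E)%E.
Proof.
elim: n => [|n IH].
  rewrite /= integral_dirac//; last first.
    by apply/measurable_EFinP; exact: measurable_gauss.
  by rewrite diracT mul1e /dotp big_ord0 oppr0 expR0.
have mcons : measurable_fun [set: T * n.-tuple T] (fun p : T * n.-tuple T => [the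
  n.+1.-tuple T of p.1 :: p.2]).
  exact: measurable_cons measurable_fst measurable_snd.
transitivity (\int[(leb \x lebesgue_tuple n)%E]_p ((@expR R (- dotp (cons_vec p)
  (cons_vec p)))%:E))%E.
  have := @ge0_integral_pushforward _ _ _ _ R _ mcons (leb \x lebesgue_tuple n)%E setT
    (fun t => (@expR R (- dotp (vec t) (vec t)))%:E) measurableT.
  rewrite preimage_setT => h; apply: etrans (h _ _) _.
  - by apply/measurable_EFinP; exact: measurable_gauss.
  - by move=> t _; rewrite lee_fin expR_ge0.
  - by apply: eq_integral => -[x t] _ /=; rewrite vec_cons.
have consvE (x : T) (t : n.-tuple T) : dotp (cons_vec (x, t)) (cons_vec (x, t)) = x
  ^+ 2 + dotp (vec t) (vec t).
  rewrite /dotp big_ord_recl /cons_vec /= row_mx00 expr2; congr (_ + _).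
  apply: eq_bigr => i _.
  have iE : lift ord0 i = rshift 1 i :> 'I_n.+1 by exact: val_inj.
  have E : row_mx (x%:M : 'M[R]_1) (vec t) 0 (rshift 1 i) = vec t 0 i by exact:
    row_mxEr.
  by rewrite iE; congr (_ * _); exact: E.
rewrite (@fubini_tonelli1 _ _ _ _ _ leb (lebesgue_tuple n) (fun p => (@expR R (-
  dotp (cons_vec p) (cons_vec p)))%:E)); last 2 first.
- apply/measurable_EFinP.
  rewrite (_ : (fun _ => _) = (fun t => @expR R (- dotp (vec t) (vec t))) \o (fun p
    : T * n.-tuple T => [the n.+1.-tuple T of p.1 :: p.2])).
    exact: measurableT_comp (@measurable_gauss n.+1) mcons.
  by apply/funext => -[x t] /=; rewrite vec_cons.
- by move=> p; rewrite lee_fin expR_ge0.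
rewrite /fubini_F.
transitivity (\int[leb]_x ((gauss_fun x)%:E * (Num.sqrt pi ^+ n)%:E))%E.
  apply: eq_integral => x _.
  rewrite -IH -ge0_integralZl//; last 2 first.
  - by apply/measurable_EFinP; exact: measurable_gauss.
  - by rewrite lee_fin gauss_fun_ge0.
  by apply: eq_integral => t _; rewrite consvE opprD expRD EFinM.
rewrite ge0_integralZr//; last 2 first.
- by apply/measurable_EFinP; exact: measurable_gauss_fun.
- by move=> x _; rewrite lee_fin gauss_fun_ge0.
by rewrite integralT_gauss -EFinM exprS.
Qed.

(** Equal to Gamma (k/2 + 1). With a square root in place of a real power the
    integrand is continuous on the whole line, and for k > 0 it vanishes on the
    negative half-line. *)
Definition sqrt_moment k : \bar R :=
  (\int[leb]_t (Num.sqrt t ^+ k * expR (- t))%:E)%E.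

Lemma continuous_sqrtX k : continuous (fun t : R => Num.sqrt t ^+ k).
Proof.
move=> x; apply: (@continuous_comp _ _ _ Num.sqrt (fun y => y ^+ k)).
  exact: sqrt_continuous.
exact: exprn_continuous.
Qed.

Lemma measurable_sqrtX k : measurable_fun [set: T] (fun t : T => Num.sqrt t ^+ k).
Proof. by apply: continuous_measurable_fun; exact: continuous_sqrtX. Qed.

Lemma measurable_sqrt_moment k :
  measurable_fun [set: T] (fun t : T => Num.sqrt t ^+ k * expR (- t)).
Proof.
apply: measurable_funM; first exact: measurable_sqrtX.
by apply: continuous_measurable_fun; exact: continuous_expRN.
Qed.

Lemma vol_sqball n (t : R) : (0 < n)%N ->
  vol [set x : 'rV[R]_n | dotp x x <= t] = ((Num.sqrt t ^+ n)%:E * vol (@eball R n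
    1))%E.
Proof.
move=> n0; have [t0|t0] := leP t 0.
  rewrite ler0_sqrtr// expr0n gtn_eqF// mul0e; apply/eqP; rewrite eq_le vol_ge0 andbT.
  have c0 : vol (@cube R n 0) = 0%E by rewrite vol_cube// mul0rn expr0n gtn_eqF.
  have [tn|tn] := ltP t 0.
    rewrite (_ : [set _ | _] = set0) ?vol_set0//; apply/seteqP; split => // x /=.
    by move=> /le_lt_trans/(_ tn); rewrite ltNge dotp_ge0.
  have -> : t = 0 by apply/eqP; rewrite eq_le t0.
  rewrite -c0 le_eqVlt; apply/orP; left; apply/eqP; congr vol; apply/seteqP;
    split => x /=.
    by move=> x0 i; have := coord_enorm x i; rewrite /enorm ler0_sqrtr.
  move=> h; suff -> : x = 0 by rewrite -(scale0r 0) dotpZl mul0r.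
  by apply/rowP => i; rewrite mxE; apply/eqP; rewrite -normr_le0; exact: h.
have s0 : 0 < Num.sqrt t by rewrite sqrtr_gt0.
rewrite -vol_scale//; last exact: borel_eball.
congr vol; apply/seteqP; split => x /=.
  move=> xt; exists ((Num.sqrt t)^-1 *: x);
    last by rewrite scalerA divff ?scale1r// gt_eqF.
  rewrite /eball /= enormZ gtr0_norm ?invr_gt0// mulrC ler_pdivrMr// mul1r.
  by rewrite /enorm ler_wsqrtr.
move=> [y y1 <-]; rewrite dotpZl dotpZr mulrA -expr2 sqr_sqrtr ?(ltW t0)//.
by rewrite ler_piMr ?(ltW t0)// -(expr1n _ 2) -enorm_le.
Qed.

(** The Gaussian integral computed over the balls |x|^2 <= t. *)
Lemma ball_sqrt_moment n : (0 < n)%N ->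
  (vol (@eball R n 1) * sqrt_moment n = (Num.sqrt pi ^+ n)%:E)%E.
Proof.
move=> n0; rewrite -integral_gauss_tuple /sqrt_moment -ge0_integralZl//; last first.
  by apply/measurable_EFinP; exact: measurable_sqrt_moment.
have := @integral_expR_layer _ _ (lebesgue_tuple n) (fun t => dotp (vec t) (vec t))
  (fun=> 1)
  (@measurable_sqdist n) (measurable_cst _) (fun=> ler01).
move=> h; transitivity (\int[lebesgue_tuple n]_t (1 * expR (- dotp (vec t) (vec t))
  : R)%:E)%E; last first.
  by apply: eq_integral => t _; rewrite mul1r.
rewrite [RHS]h; apply: eq_integral => t _.
have mA : measurable (@vec R n @^-1` [set x | dotp x x <= t]).
  by apply: measurable_le_set; [exact: measurable_sqdist|exact: measurable_cst].
have hv : lebesgue_tuple n [set u : n.-tuple T | dotp (vec u) (vec u) <= t] =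
  ((Num.sqrt t ^+ n)%:E * vol (@eball R n 1))%E := vol_sqball t n0.
rewrite /= integral_cst// mul1e [X in (_ = _ * X)%E]hv.
by rewrite EFinM [RHS]muleA [(_%:E * _%:E)%E in RHS]muleC [RHS]muleC.
Qed.

(** The recursion Gamma (a + 1) = a Gamma a for a = (k + 3) / 2, obtained from
    t^a = integral of a s^(a-1) over 0 <= s <= t. *)
Lemma sqrt_momentS k :
  sqrt_moment k.+3 = ((k.+3%:R / 2)%:E * sqrt_moment k.+1)%E.
Proof.
pose f (s : R) := k.+3%:R / 2 * Num.sqrt s ^+ k.+1.
have f0 s : 0 <= f s by rewrite mulr_ge0// exprn_ge0// sqrtr_ge0.
have fN s : s < 0 -> f s = 0 by move=> s0; rewrite /f ltr0_sqrtr// expr0n mulr0.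
have cf : continuous f.
  by move=> x; apply: cvgM; [exact: cvg_cst|exact: continuous_sqrtX].
have mf : measurable_fun [set: T] f by exact: continuous_measurable_fun.
have intf (t : R) : (\int[leb]_(s in [set s : R | (s <= t)%R]) (f s)%:E = (Num.sqrt
  t ^+ k.+3)%:E)%E.
  have [t0|t0] := ltP t 0.
    rewrite ltr0_sqrtr// expr0n /=; apply: integral0_eq => s /= st.
    by rewrite fN// (le_lt_trans st).
  transitivity (\int[leb]_(s in `[0%R, t]) (f s)%:E)%E.
    rewrite integral_mkcond [RHS]integral_mkcond; apply: eq_integral => s _.
    rewrite !patchE; case: (ltP s 0) => s0; first by rewrite fN//; do 2 case: ifP.
    congr (if _ then _ else _); apply/idP/idP; rewrite !inE /= in_itv/= s0//.
  have dF (x : R) : 0 < x -> is_derive x 1 (fun s : R => Num.sqrt s ^+ k.+3) (f x).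
    move=> x0; have h := is_deriveX k.+3 (is_derive1_sqrt x0).
    rewrite (_ : (fun _ => _) = (@Num.sqrt R) ^+ k.+3); last first.
      by apply/funext => s; rewrite exprfctE.
    apply: (is_derive_eq h); rewrite -[LHS]/(k.+3%:R * Num.sqrt x ^+ k.+2 * (2 *
      Num.sqrt x)^-1).
    have sx : Num.sqrt x != 0 by rewrite gt_eqF// sqrtr_gt0.
    by rewrite /f exprS; field.
  rewrite (integral_FTC t0 cf (@continuous_sqrtX _) dF).
  by rewrite sqrtr0 expr0n subr0.
have := @integral_expR_layer _ _ leb (fun s : T => s) f (@measurable_id _ _ setT) mf f0.
under [X in _ = X -> _]eq_integral => t _ do rewrite intf -EFinM mulrC.
rewrite -/(sqrt_moment k.+3) => <-.
rewrite /sqrt_moment -ge0_integralZl//; last first.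
  by apply/measurable_EFinP; exact: measurable_sqrt_moment.
by apply: eq_integral => t _; rewrite -EFinM mulrA.
Qed.

(** [Gamma] is a real number, defined by truncating a possibly infinite
    integral; hence the finiteness hypothesis. *)
Lemma Gamma_sqrt_moment k :
  sqrt_moment k.+1 \is a fin_num -> sqrt_moment k.+1 = (Gamma (k.+3%:R / 2 : R))%:E.
Proof.
move=> fin; rewrite /Gamma /Rintegral -[LHS](fineK fin); congr (fine _)%:E.
rewrite [RHS]integral_mkcond; apply: eq_integral => t _.
rewrite patchE; have tE : (t \in `]0%R, +oo[%classic) = (0 < t).
  by apply/idP/idP; rewrite inE /= in_itv/= andbT.
rewrite tE; case: ltP => t0.
  congr (_ * _)%:E.
  rewrite -powR12_sqrt ?ltW// -powR_mulrn ?powR_ge0// -powRrM.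
  by congr powR; rewrite -[k.+3]addn2 natrD; field.
by rewrite ler0_sqrtr// expr0n mul0r.
Qed.

Lemma truncated_cone_sphere n : truncated_cone (@esphere R n `&` @esphere R n) =
  @punctured_ball R n.
Proof.
rewrite setIid; apply/seteqP; split => x.
  move=> [r]; rewrite /= in_itv/= => /andP[r0 r1] [u u1 <-]; split => /=.
    by rewrite /eball /= enormZ u1 mulr1 gtr0_norm.
  by move=> /eqP; rewrite -enorm_eq0 enormZ u1 mulr1 normr_eq0 gt_eqF.
move=> [x1 /= /eqP x0]; exists (enorm x) => /=.
  by rewrite in_itv/= x1 lt_neqAle eq_sym enorm_eq0 x0 enorm_ge0.
by exists (unit_dir x); [exact: enorm_unit_dir|rewrite -unit_dirE].
Qed.

Lemma vol_punctured_ball n : (0 < n)%N ->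
  vol (@punctured_ball R n) = vol (@eball R n 1).
Proof.
move=> n0; have -> : eball 1 = @punctured_ball R n `|` [set 0].
  apply/seteqP; split => x; first by move=> x1; have [->|/eqP x0] := eqVneq x 0;
    [right|left].
  by move=> [[]//|->]; exact: eball0.
have v0 : vol [set (0 : 'rV[R]_n)] = 0%E.
  apply/eqP; rewrite eq_le vol_ge0 andbT.
  have <- : vol (@cube R n 0) = 0%E by rewrite vol_cube// mul0rn expr0n gtn_eqF.
  apply: vol_le; [exact: borel0|exact: borel_cube|].
  by move=> x /= -> i; rewrite mxE normr0.
have := @measureU _ _ _ (lebesgue_tuple n) _ _ (@borel_punctured_ball R n) (@borel0
  R n).
rewrite -/(vol _) => h; rewrite /vol.
apply/esym; apply: etrans (h _) _.
  by apply/seteqP; split => t // -[[_ h1] h2]; exact: h1.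
by rewrite -[X in (_ + X)%E]/(vol [set 0]) v0 adde0.
Qed.

(** By [ball_sqrt_moment] and [sqrt_momentS],
    vol(B) (n/2) Gamma (n/2) = pi^(n/2) in dimension n = k + 3, and the surface
    measure is n vol(B). *)
Theorem sphere_measureE k :
  sphere_measure (@esphere R k.+3) =
  (2 * Num.sqrt pi ^+ k.+3 / Gamma (k.+3%:R / 2))%:E /\ 0 < Gamma (k.+3%:R / 2 : R).
Proof.
have h := @ball_sqrt_moment k.+3 isT.
have V0 := @vol_eball_gt0 R k.+3.
have VE : vol (@eball R k.+3 1) = (fine (vol (@eball R k.+3 1)))%:E.
  by rewrite fineK// ge0_fin_numE ?vol_ge0// vol_eball_fin.
set V := fine _ in VE.
have V0' : 0 < V by rewrite -lte_fin -VE.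
have J0 : (0 <= sqrt_moment k.+1)%E.
  by apply: integral_ge0 => t _;
    rewrite lee_fin mulr_ge0 ?exprn_ge0 ?sqrtr_ge0 ?expR_ge0.
have c0 : 0 < k.+3%:R / 2 :> R by rewrite divr_gt0.
have P0 : 0 < Num.sqrt pi ^+ k.+3 :> R by rewrite exprn_gt0// sqrtr_gt0 pi_gt0.
move: h; rewrite sqrt_momentS VE => h.
have Jfin : sqrt_moment k.+1 \is a fin_num.
  rewrite ge0_fin_numE//; move: J0 h; case: (sqrt_moment k.+1) => [x| |] //;
    rewrite ?ltry//.
  by move=> _; rewrite gt0_muley ?lte_fin// gt0_muley ?lte_fin.
move: h; rewrite (Gamma_sqrt_moment Jfin); set G := Gamma _; rewrite -!EFinM => -[h].
have G0 : 0 < G.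
  rewrite -(pmulr_rgt0 _ c0) -(pmulr_rgt0 _ V0') h; exact: P0.
split => //; rewrite /sphere_measure truncated_cone_sphere vol_punctured_ball//
  VE -EFinM -h.
congr EFin.
have : (k.+3%:R : R) != 0 by rewrite pnatr_eq0.
move: (k.+3%:R : R) => N N0; field; exact/lt0r_neq0.
Qed.

End ball_volume.

(** * The volume product inequality *)

Theorem theorem1p2 (R : realType) (n : nat) (K : set 'rV[R]_n) :
  (4 <= n)%N -> convex_body K -> symmetric_body K ->
  (vol K * vol (polar K) >=
     alpha (n - 1) * sphere_measure (@esphere R n) ^+ 2)%E /\
  (alpha (n - 1) * sphere_measure (@esphere R n) ^+ 2 =
     (4 : R)%:E * alpha (n - 1) * (pi ^+ n)%:E
       / (Gamma (n%:R / 2) ^+ 2)%:E)%E.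
Proof.
case: n K => [|[|[|[|k]]]] // K _ bK sK; rewrite subn1 -[k.+4.-1]/k.+3.
split.
  apply: le_trans (vol_product_ge _ bK sK) => //.
  have sE : sphere_measure (@esphere R k.+4) = (k.+4%:R%:E * vol (@punctured_ball R
    k.+4))%E.
    by rewrite /sphere_measure truncated_cone_sphere.
  have VE : vol (@punctured_ball R k.+4) = (fine (vol (@punctured_ball R k.+4)))%:E
    by apply: esym; apply: fineK; exact: vol_punctured_ball_fin.
  rewrite sE VE; set V := fine _.
  apply: le_trans (lee_wpmul2r _ (@alpha_le R k.+3 isT)) _.
    by rewrite -EFinM -EFin_expe lee_fin sqr_ge0.
  rewrite -EFinM -!EFin_expe -!EFinM lee_fin exprMn le_eqVlt; apply/orP; left.
  have : (k.+4%:R : R) != 0 by rewrite pnatr_eq0.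
  by move: (k.+4%:R : R) => N N0; apply/eqP; field.
have [-> G0] := @sphere_measureE R k.+1.
rewrite [(_ * alpha _)%E]muleC -!muleA; congr (_ * _)%E.
rewrite inver gt_eqF ?exprn_gt0// -EFin_expe -!EFinM; congr EFin.
rewrite expr_div_n exprMn -natrX -exprM mulnC exprM sqr_sqrtr ?pi_ge0//.
by rewrite mulrA.
Qed.
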